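(* Let $T^n$ be an $n$-dimensional flat torus, $\alpha,\alpha',\beta,\beta'>0$ and $1\le p\le n$. If $n\ne 2p$, then $F_{\alpha\beta,p}^{T^n}$ and $F_{\alpha'\beta',p}^{T^n}$ are isospectral if and only if $(\alpha,\beta)=(\alpha',\beta')$. If $n=2p$, then $F_{\alpha\beta,p}^{T^n}$ and $F_{\alpha'\beta',p}^{T^n}$ are isospectral if and only if $\{\alpha,\beta\}=\{\alpha',\beta'\}$.
   Context: A flat torus is $T^n=\mathbb{R}^n/\Lambda$, where the lattice $\Lambda$ is the $\mathbb{Z}$-span of a basis of $\mathbb{R}^n$, with the metric induced by the standard metric of $\mathbb{R}^n$. For a compact Riemannian manifold $M$, $d$ is the exterior derivative, $\delta$ its formal $L^2$-adjoint, and $F_{\alpha\beta,p}^M:=\alpha d\delta+\beta\delta d$ on smooth $p$-forms. Its spectrum is the function assigning to each $\lambda\in\mathbb{C}$ the dimension of $\{\omega\in\Omega^p(M)\mid F_{\alpha\beta,p}^M\omega=\lambda\omega\}$. Two operators are isospectral if their spectra (with multiplicities) coincide.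
   Formalization: For p = n the printed claim is false, since F = α dδ does not depend on β (e.g. n = p = 1, α = α' = 1, β = 1, β' = 2); the first equivalence is therefore stated for n ≠ 2p and p ≠ n, and for p = n isospectrality is shown to be equivalent to α = α'. *)

(* Defs.v *)
From HB Require Import structures.
From mathcomp Require Import all_boot all_order all_algebra.
From mathcomp Require Import complex.
From mathcomp Require Import all_classical all_reals all_analysis.

Set Implicit Arguments.
Unset Strict Implicit.
Unset Printing Implicit Defensive.

Import Order.TTheory GRing.Theory Num.Theory.
Import numFieldNormedType.Exports.

Local Open Scope classical_set_scope.
Local Open Scope ring_scope.

Section Dimension.
Context {K : fieldType} {V : lmodType K}.

Definition has_dim (E : set V) (k : nat) : Prop :=
  exists e : 'I_k -> V,
    (forall v, E v <-> exists c : 'rV[K]_k, v = \sum_(i < k) c 0 i *: e i) /\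
    (forall c : 'rV[K]_k, \sum_(i < k) c 0 i *: e i = 0 -> c = 0).

(* None stands for infinite dimension (and for sets that are not subspaces). *)
Definition dimension (E : set V) : option nat :=
  xget None [set Some k | k in has_dim E].

End Dimension.

Section Forms.
Context {R : realType} {n : nat}.

(* An exterior form on R^n with complex coefficients, not necessarily
   homogeneous: [w x I] is the coefficient at x of
   dx_I = dx_{i1} /\ ... /\ dx_{ip}, where i1 < ... < ip enumerate I. *)
Definition dform := 'rV[R]_n -> {set 'I_n} -> R[i]^o.

Definition pderiv (j : 'I_n) (f : 'rV[R]_n -> R) : 'rV[R]_n -> R :=
  fun x => 'D_(delta_mx 0 j) f x.

Definition smooth (f : 'rV[R]_n -> R) : Prop :=
  forall (s : seq 'I_n) (x : 'rV[R]_n), differentiable (foldr pderiv f s) x.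

Definition csmooth (f : 'rV[R]_n -> R[i]) : Prop :=
  smooth (@complex.Re R \o f) /\ smooth (@complex.Im R \o f).

Definition cpderiv (j : 'I_n) (f : 'rV[R]_n -> R[i]) : 'rV[R]_n -> R[i] :=
  fun x => (pderiv j (@complex.Re R \o f) x +i* pderiv j (@complex.Im R \o f) x)%C.

(* dw = \sum_j dx_j /\ (partial_j w).  The sign moves dx_j past the dx_i
   with i < j. *)
Definition ext_deriv (w : dform) : dform := fun x J =>
  \sum_(j in J) (-1) ^+ #|[pred i in J | (i < j)%N]|
                * cpderiv j (fun y => w y (J :\ j)) x.

End Forms.

Arguments dform : clear implicits.

Fixpoint cube_integral {R : realType} (n : nat) : ('rV[R]_n -> R) -> R :=
  match n with
  | 0 => fun f => f 0
  | n'.+1 => fun f =>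
      \int[@lebesgue_measure R]_(t in `[0, 1])
        cube_integral (fun u : 'rV[R]_n' => f (row_mx (t%:M : 'rV[R]_1) u))
  end.

(* The flat torus R^n / Lambda, where Lambda is spanned by the rows of B.
   Objects on the torus are Lambda-periodic objects on R^n. *)
Section FlatTorus.
Context {R : realType} {n : nat} (B : 'M[R]_n).

Definition lattice : set 'rV[R]_n :=
  [set map_mx intr z *m B | z in [set: 'rV[int]_n]].

(* The space of smooth forms of all degrees on the torus. *)
Definition Omega_all : set (dform R n) :=
  [set w | (forall I, csmooth (fun x => w x I)) /\
           (forall x v, lattice v -> w (x + v) = w x)].

Definition Omega (p : nat) : set (dform R n) :=
  [set w | Omega_all w /\ forall x (I : {set 'I_n}), #|I| != p -> w x I = 0].

(* The Riemannian volume integral of a periodic function: the unit cube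
   parametrizes the fundamental domain spanned by the rows of B. *)
Definition torus_integral (f : 'rV[R]_n -> R) : R :=
  `|\det B| * cube_integral (fun u => f (u *m B)).

Definition torus_cintegral (f : 'rV[R]_n -> R[i]) : R[i] :=
  (torus_integral (@complex.Re R \o f) +i* torus_integral (@complex.Im R \o f))%C.

(* The dx_I are pointwise orthonormal. *)
Definition L2_inner (w h : dform R n) : R[i] :=
  torus_cintegral (fun x => \sum_(I : {set 'I_n}) w x I * (h x I)^*).

(* Taking the adjoint on forms of all degrees at once is the same as taking
   it degree by degree, as forms of different degrees are L2-orthogonal. *)
Definition codiff (w : dform R n) : dform R n :=
  xget (0 : dform R n) [set h | Omega_all h /\
    forall t, Omega_all t -> L2_inner (ext_deriv t) w = L2_inner t h].

Definition F_op (a b : R) (w : dform R n) : dform R n :=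
  a%:C%C *: ext_deriv (codiff w) + b%:C%C *: codiff (ext_deriv w).

Definition spectrum (p : nat) (F : dform R n -> dform R n) : R[i] -> option nat :=
  fun l => dimension [set w | Omega p w /\ F w = l *: w].

Definition isospectral (p : nat) (F G : dform R n -> dform R n) : Prop :=
  spectrum p F = spectrum p G.

End FlatTorus.

(* Main.v *)
Require Import Defs.
From HB Require Import structures.
From mathcomp Require Import all_boot all_order all_algebra.
From mathcomp Require Import complex.
From mathcomp Require Import all_classical all_reals all_analysis.
From mathcomp Require Import ring lra zify.

(** On the Fourier modes of the torus the operator F becomes algebra.  For an
    integer vector m let e_m be the corresponding character of the torus and
    xi its frequency vector, a point of the dual lattice scaled by 2 pi.  On
    forms e_m * c with constant coefficients c, the derivative d acts as i times
    the wedge with xi, and delta as -i times the contraction by xi, so that F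
    acts on c as a * (wedge o contraction) + b * (contraction o wedge).  When xi
    is nonzero these two products are, up to the factor s = |xi|^2, complementary
    projections of the p-covectors, of ranks A = 'C(n-1, p-1) and
    D = 'C(n-1, p); when xi = 0 both vanish.  Hence, with N(s) the number of
    modes of squared frequency s, the multiplicity of a positive eigenvalue l is
       A * N(l / a) + D * N(l / b)            (lemma [spectrum_pos]).

    This description rests on two analytic facts.  Integration by parts on the
    torus ([torus_cintegral_by_parts]) shows that the adjoint of d is the
    expected first-order operator ([codiffE]) and gives the action of d and
    delta on Fourier coefficients.  Completeness of the modes ([fourier_inj])
    shows that a smooth form is determined by its coefficients, so that an
    eigenform is a finite combination of modes ([eigenspaceE]).  Completeness is
    proved one variable at a time; in one variable a continuous function
    orthogonal to all trigonometric polynomials vanishes because powers of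
    c + cos (2 pi (t - t0)) concentrate at t0 ([trig_uniqueness_le0]).

    It remains to read the constants off the counting function
    ([scaled_counts_eq]).  Let s be the smallest positive squared frequency.  For
    p < n the smallest positive eigenvalue is s * min(a, b), so the spectrum
    determines min(a, b).  Its multiplicity tells whether the minimum is attained by a or by
    b, unless A = D, that is n = 2p; removing the corresponding summand leaves a
    multiple of N(l / c), whose first jump determines the other constant c.  If
    A = D the multiplicities are symmetric in a and b.  If p = n then D = 0, so
    the spectrum is independent of b and determines a in the same way. *)

Import Order.TTheory GRing.Theory Num.Theory.
Import numFieldNormedType.Exports.

Set Implicit Arguments.
Unset Strict Implicit.
Unset Printing Implicit Defensive.

Local Open Scope classical_set_scope.
Local Open Scope ring_scope.

(** * Integration over the unit cube *)

Section ContinuousReal.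
Context {R : realType} {T : topologicalType}.
Implicit Types f g : T -> R.

Lemma cts_cst (c : R) : continuous (fun _ : T => c).
Proof. by move=> x; exact: cvg_cst. Qed.

Lemma ctsD f g : continuous f -> continuous g -> continuous (fun x => f x + g x).
Proof. by move=> cf cg x; apply: (@continuousD _ _ _ f g x); [exact: cf|exact: cg]. Qed.

Lemma ctsB f g : continuous f -> continuous g -> continuous (fun x => f x - g x).
Proof. by move=> cf cg x; apply: (@continuousB _ _ _ f g x); [exact: cf|exact: cg]. Qed.

Lemma ctsM f g : continuous f -> continuous g -> continuous (fun x => f x * g x).
Proof. by move=> cf cg x; apply: (@continuousM _ _ f g x); [exact: cf|exact: cg]. Qed.

Lemma cts_sum (I : Type) (r : seq I) (P : pred I) (F : I -> T -> R) :
  (forall i, P i -> continuous (F i)) -> continuous (fun x => \sum_(i <- r | P i) F i x).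
Proof.
move=> cF; elim: r => [|i r IH].
  by under eq_fun do rewrite big_nil; exact: cts_cst.
case Pi: (P i); last by under eq_fun do rewrite big_cons Pi; exact: IH.
under eq_fun do rewrite big_cons Pi.
by apply: ctsD => //; exact: cF.
Qed.

End ContinuousReal.

Section CubeIntegral.
Context {R : realType}.
Implicit Types (n : nat).

Lemma cvg_rV (T : Type) (F : set_system T) (FF : Filter F) n (f : T -> 'rV[R]_n) (l : 'rV[R]_n) :
  (forall i, (fun t => f t 0 i) @ F --> l 0 i) -> f @ F --> l.
Proof.
move=> fl; apply/cvgrPdist_lt => e e0.
have : \forall t \near F, forall i, `|l 0 i - f t 0 i| < e.
  by apply: filter_forall => i; move/cvgrPdist_lt : (fl i); apply.
apply: filterS => t lt.
have := @mx_norm_ball R 1 n; move/(congr1 (fun g => g l e (f t))).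
rewrite /ball_ /= => E; suff : ball l e (f t) by rewrite E.
by split=> // i j; rewrite ord1; exact: lt.
Qed.

Definition cube n : set 'rV[R]_n := [set u | forall i, u 0 i \in `[0, 1]].

Lemma cube_compact n : compact (@cube n).
Proof.
apply: (@rV_compact R n (fun=> `[0, 1]%classic)) => _; exact: segment_compact.
Qed.

Definition cons_rV n (t : R) (u : 'rV[R]_n) : 'rV[R]_n.+1 :=
  row_mx (t%:M : 'rV[R]_1) u.

Lemma cons_rV0 n t (u : 'rV[R]_n) : cons_rV t u 0 0 = t.
Proof.
rewrite /cons_rV (_ : 0 = lshift n (0 : 'I_1)); last exact/val_inj.
by rewrite (@row_mxEl _ 1 1 n) mxE eqxx mulr1n.
Qed.

Lemma cons_rVS n t (u : 'rV[R]_n) i : cons_rV t u 0 (lift ord0 i) = u 0 i.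
Proof.
rewrite /cons_rV (_ : lift ord0 i = rshift 1 i); last exact/val_inj.
by rewrite (@row_mxEr _ 1 1 n).
Qed.

Lemma cons_rV_surj n (x : 'rV[R]_n.+1) :
  x = cons_rV (x 0 0) (\row_i x 0 (lift ord0 i)).
Proof.
apply/rowP => i; case: (unliftP ord0 i) => [j ->|->].
  by rewrite cons_rVS mxE.
by rewrite cons_rV0.
Qed.

Lemma cons_rV_cube n t (u : 'rV[R]_n) :
  t \in `[0, 1] -> cube u -> cube (cons_rV t u).
Proof.
move=> t01 u01 i; case: (unliftP ord0 i) => [j ->|->].
  by rewrite cons_rVS.
by rewrite cons_rV0.
Qed.

Lemma continuous_cons_rV n : continuous (fun p : R * 'rV[R]_n => cons_rV p.1 p.2).
Proof.
move=> p; apply: cvg_rV => i; case: (unliftP ord0 i) => [j ->|->].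
  under eq_cvg do rewrite cons_rVS; rewrite cons_rVS.
  apply: (@continuous_comp _ _ _ (fun p : R * 'rV[R]_n => p.2) (fun u : 'rV[R]_n => u 0 j)).
    exact: cvg_snd.
  exact: coord_continuous.
under eq_cvg do rewrite cons_rV0; rewrite cons_rV0; exact: cvg_fst.
Qed.

Lemma continuous_slice n (f : 'rV[R]_n.+1 -> R) t :
  continuous f -> continuous (fun u => f (cons_rV t u)).
Proof.
move=> cf u; apply: (@continuous_comp _ _ _ (cons_rV t) f); last exact: cf.
apply: (@continuous_comp _ _ _ (fun u : 'rV[R]_n => (t, u))
  (fun p : R * 'rV[R]_n => cons_rV p.1 p.2)); last exact: continuous_cons_rV.
by apply: (@cvg_pair _ _ _ (nbhs u) (nbhs t) (nbhs u) _ _ _ (fun=> t) id); [exact: cvg_cst | exact: cvg_id].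
Qed.

(** The tube lemma: continuity at each point of the compact set {t} x cube gives
    a neighbourhood of t that works for the whole cube.  It replaces uniform
    continuity wherever a limit is exchanged with the cube integral. *)
Lemma slice_near n (f : 'rV[R]_n.+1 -> R) t e : continuous f -> 0 < e ->
  \forall s \near t, forall u, cube u ->
    `|f (cons_rV t u) - f (cons_rV s u)| < e.
Proof.
move=> cf e0.
have /compact_near_coveringP := @cube_compact n.
move=> /(_ R (nbhs t) (fun s u => `|f (cons_rV t u) - f (cons_rV s u)| < e) (nbhs_filter t)) H.
refine (H _) => {H} u _.
have fc : {for (t, u), continuous (fun p : R * 'rV[R]_n => f (cons_rV p.1 p.2))}.
  apply: (@continuous_comp _ _ _ (fun p : R * 'rV[R]_n => cons_rV p.1 p.2) f).
    exact: continuous_cons_rV.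
  exact: cf.
have e20 : 0 < e / 2 by rewrite divr_gt0.
move/cvgrPdist_lt : (fc) => /(_ _ e20) [[A1 A2]/= [A1t A2u] A12].
exists (A2, A1) => //= -[v s] /= [A2v A1s].
have h1 := A12 (s, v) (conj A1s A2v).
have h2 := A12 (t, v) (conj (nbhs_singleton A1t) A2v).
rewrite /= in h1 h2.
rewrite (_ : _ - _ = (f (cons_rV t u) - f (cons_rV s v)) -
  (f (cons_rV t u) - f (cons_rV t v))); last by ring.
rewrite (le_lt_trans (ler_normB _ _))// (splitr e) ltrD//.
Qed.

Let mu := @lebesgue_measure R.

Lemma continuous_integrable01 (h : R -> R) :
  continuous h -> mu.-integrable `[0, 1] (EFin \o h).
Proof.
move=> ch; apply: continuous_compact_integrable; first exact: segment_compact.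
exact: continuous_subspaceT.
Qed.

Let mu01 : fine (mu `[0, 1]%classic) = 1.
Proof. by rewrite /mu lebesgue_measure_itv/= lte_fin ltr01 oppr0 adde0. Qed.

(** The cube integral is iterated, so linearity and monotonicity in dimension
    n.+1 need integrability of the inner integral, hence its continuity in the
    outer variable, which in turn follows from linearity and monotonicity in
    dimension n.  One induction therefore proves all these properties. *)
Lemma cube_integral_spec n :
  [/\ forall f g : 'rV[R]_n -> R, continuous f -> continuous g ->
        cube_integral (fun x => f x + g x) = cube_integral f + cube_integral g,
      forall c (f : 'rV[R]_n -> R), continuous f ->
        cube_integral (fun x => c * f x) = c * cube_integral f,
      forall c, cube_integral (fun _ : 'rV[R]_n => c) = c
    & forall f g : 'rV[R]_n -> R, continuous f -> continuous g ->
        (forall u, cube u -> f u <= g u) ->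
        cube_integral f <= cube_integral g] /\
  forall f : 'rV[R]_n.+1 -> R, continuous f ->
    continuous (fun t => cube_integral (fun u => f (cons_rV t u))).
Proof.
elim: n => [|n [[ID IZ IC IM] IS]].
  split; first by split => //= f g _ _; apply => -[].
  move=> f cf t; apply/cvgrPdist_lt => e e0 /=.
  near=> s; near: s; have := slice_near t cf e0.
  by apply: filterS => s; apply => -[].
have H : [/\ forall f g : 'rV[R]_n.+1 -> R, continuous f -> continuous g ->
        cube_integral (fun x => f x + g x) = cube_integral f + cube_integral g,
      forall c (f : 'rV[R]_n.+1 -> R), continuous f ->
        cube_integral (fun x => c * f x) = c * cube_integral f,
      forall c, cube_integral (fun _ : 'rV[R]_n.+1 => c) = c
    & forall f g : 'rV[R]_n.+1 -> R, continuous f -> continuous g ->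
        (forall u, cube u -> f u <= g u) ->
        cube_integral f <= cube_integral g].
  split=> [f g cf cg|c f cf|c|f g cf cg fg] /=.
  - rewrite -RintegralD//; [|exact: continuous_integrable01 (IS _ cf)
                            |exact: continuous_integrable01 (IS _ cg)].
    by apply: eq_Rintegral => t _; rewrite ID//; exact: continuous_slice.
  - rewrite -RintegralZl//; last exact: continuous_integrable01 (IS _ cf).
    by apply: eq_Rintegral => t _; rewrite IZ//; exact: continuous_slice.
  - under eq_Rintegral do rewrite IC.
    by rewrite Rintegral_cst// [fine _]mu01 mulr1.
  - apply: le_Rintegral => //.
    + exact: continuous_integrable01 (IS _ cf).
    + exact: continuous_integrable01 (IS _ cg).
    + move=> t t01; apply: IM; [exact: continuous_slice|exact: continuous_slice|].
      by move=> u u01; apply: fg; exact: cons_rV_cube.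
split=> // f cf t.
move: H => [HD HZ HC HM].
apply/cvgrPdist_lt => e e0.
have e20 : 0 < e / 2 by rewrite divr_gt0.
have := slice_near t cf e20.
apply: filterS => s ds.
have ct := continuous_slice (t := t) cf; have cs := continuous_slice (t := s) cf.
have cN (g : 'rV[R]_n.+1 -> R) : continuous g -> continuous (fun x => -1 * g x).
  by move=> cg; apply: ctsM => //; exact: cts_cst.
have cB : continuous (fun u => f (cons_rV t u) + -1 * f (cons_rV s u)).
  by apply: ctsD => //; exact: cN.
rewrite -[X in _ + X]mulN1r -HZ// -HD//; last exact: cN.
apply: (@le_lt_trans _ _ (e / 2)); last by rewrite gtr_pMr ?invf_lt1 ?ltr1n.
rewrite ler_norml; apply/andP; split.
  rewrite -[leLHS]HC; apply: HM => //; first exact: cts_cst.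
  by move=> u /ds; rewrite mulN1r ltr_norml => /andP[/ltW].
rewrite -[leRHS]HC; apply: HM => //; first exact: cts_cst.
by move=> u /ds; rewrite mulN1r ltr_norml => /andP[_ /ltW].
Unshelve. all: by end_near.
Qed.

Lemma cube_integralD n (f g : 'rV[R]_n -> R) : continuous f -> continuous g ->
  cube_integral (fun x => f x + g x) = cube_integral f + cube_integral g.
Proof. by have [[]] := cube_integral_spec n => + _ _ _ _; apply. Qed.

Lemma cube_integralZ n c (f : 'rV[R]_n -> R) : continuous f ->
  cube_integral (fun x => c * f x) = c * cube_integral f.
Proof. by have [[]] := cube_integral_spec n => _ + _ _ _; apply. Qed.

Lemma cube_integral_cst n c : cube_integral (fun _ : 'rV[R]_n => c) = c.
Proof. by have [[]] := cube_integral_spec n. Qed.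

Lemma le_cube_integral n (f g : 'rV[R]_n -> R) : continuous f -> continuous g ->
  (forall u, cube u -> f u <= g u) -> cube_integral f <= cube_integral g.
Proof. by have [[]] := cube_integral_spec n => _ _ _ + _; apply. Qed.

Lemma continuous_cube_integral n (f : 'rV[R]_n.+1 -> R) : continuous f ->
  continuous (fun t => cube_integral (fun u => f (cons_rV t u))).
Proof. by have [_] := cube_integral_spec n; apply. Qed.

Lemma cube_integral_sum n (I : Type) (r : seq I) (F : I -> 'rV[R]_n -> R) :
  (forall i, continuous (F i)) ->
  cube_integral (fun x => \sum_(i <- r) F i x) = \sum_(i <- r) cube_integral (F i).
Proof.
move=> cF; elim: r => [|i r IH].
  by under eq_fun do rewrite big_nil; rewrite big_nil cube_integral_cst.
under eq_fun do rewrite big_cons; rewrite big_cons -IH cube_integralD//.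
exact: cts_sum.
Qed.

Lemma cube_integralB n (f g : 'rV[R]_n -> R) : continuous f -> continuous g ->
  cube_integral (fun x => f x - g x) = cube_integral f - cube_integral g.
Proof.
move=> cf cg; rewrite -[X in _ + X]mulN1r -cube_integralZ// -cube_integralD//.
  by congr cube_integral; apply/funext => x; rewrite mulN1r.
by apply: ctsM => //; exact: cts_cst.
Qed.

Lemma cube_integral_norm_le n (f : 'rV[R]_n -> R) e : continuous f ->
  (forall u, cube u -> `|f u| <= e) -> `|cube_integral f| <= e.
Proof.
have cc (c : R) : continuous (fun _ : 'rV[R]_n => c) by exact: cts_cst.
move=> cf fe; rewrite ler_norml -{1}(cube_integral_cst n (- e)).
rewrite -{2}(cube_integral_cst n e); apply/andP; split; apply: le_cube_integral => //.
  by move=> u /fe; rewrite ler_norml => /andP[].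
by move=> u /fe; rewrite ler_norml => /andP[].
Qed.

End CubeIntegral.

(** * Differentiation under the cube integral *)

Section DerivUnderIntegral.
Context {R : realType}.

Lemma cons_rVD n s t (u v : 'rV[R]_n) :
  cons_rV s u + cons_rV t v = cons_rV (s + t) (u + v).
Proof.
apply/rowP => i; rewrite mxE; case: (unliftP ord0 i) => [j ->|->].
  by rewrite !cons_rVS mxE.
by rewrite !cons_rV0.
Qed.

Lemma cons_rVZ n h t (u : 'rV[R]_n) : h *: cons_rV t u = cons_rV (h * t) (h *: u).
Proof.
apply/rowP => i; rewrite mxE; case: (unliftP ord0 i) => [j ->|->].
  by rewrite !cons_rVS mxE.
by rewrite !cons_rV0.
Qed.

Lemma delta_cons0 n : delta_mx 0 ord0 = cons_rV 1 (0 : 'rV[R]_n).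
Proof.
apply/rowP => i; rewrite mxE; case: (unliftP ord0 i) => [j ->|->].
  by rewrite !cons_rVS mxE.
by rewrite cons_rV0.
Qed.

Lemma delta_consS n (j : 'I_n) :
  delta_mx 0 (lift ord0 j) = cons_rV 0 (delta_mx 0 j : 'rV[R]_n).
Proof.
apply/rowP => i; rewrite mxE; case: (unliftP ord0 i) => [k ->|->].
  by rewrite !cons_rVS mxE /= (inj_eq lift_inj).
by rewrite cons_rV0.
Qed.

Lemma derivable_slice0 n (F : 'rV[R]_n.+1 -> R) u t :
  derivable F (cons_rV t u) (delta_mx 0 ord0) ->
  is_derive t 1 (fun s => F (cons_rV s u)) ('D_(delta_mx 0 ord0) F (cons_rV t u)).
Proof.
have E : (fun h : R => h^-1 *: (F (cons_rV (h *: 1 + t) u) - F (cons_rV t u))) =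
  (fun h : R => h^-1 *: (F (h *: delta_mx 0 ord0 + cons_rV t u) - F (cons_rV t u))).
  apply/funext => h; congr (_ *: (F _ - _)).
  by rewrite delta_cons0 cons_rVZ cons_rVD scaler0 add0r.
move=> dF; apply: DeriveDef; first by rewrite /derivable /= E.
by rewrite /derive /= E.
Qed.

(** By the mean value theorem the difference quotient of F is a value of its
    partial derivative at a nearby point, uniformly close by [slice_near]. *)
Lemma cube_integral_is_derive n (F : 'rV[R]_n.+1 -> R) (t : R) :
  continuous F -> (forall x, derivable F x (delta_mx 0 ord0)) ->
  continuous ('D_(delta_mx 0 ord0) F) ->
  is_derive t 1 (fun t : R => cube_integral (fun u => F (cons_rV t u)))
    (cube_integral (fun u => 'D_(delta_mx 0 ord0) F (cons_rV t u))).
Proof.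
move=> cF dF cDF; set D := 'D_(delta_mx 0 ord0) F.
set G := fun t => _; set l := cube_integral _.
suff H : (fun h : R => h^-1 *: (G (h *: 1 + t) - G t)) @ 0^' --> l.
  apply: DeriveDef; first by apply/cvg_ex; exists l; exact: H.
  by apply: cvg_lim => //; exact: H.
apply/cvgrPdist_le => e e0.
have /nbhs_ballP[d /= d0 hd] := slice_near t cDF e0.
near=> h.
have h0 : h != 0 by near: h; exact: nbhs_dnbhs_neq.
have hd' : `|h| < d.
  near: h; apply: dnbhs0_lt => //.
have mvt u : exists2 c, `|t - c| < d &
    F (cons_rV (h *: 1 + t) u) - F (cons_rV t u) = h * D (cons_rV c u).
  have dphi (s : R) : is_derive s 1 (fun s : R => F (cons_rV s u)) (D (cons_rV s u)).
    exact: derivable_slice0.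
  have cphi : continuous (fun s : R => F (cons_rV s u)).
    by move=> s; apply/differentiable_continuous/derivable1_diffP; apply: ex_derive.
  rewrite [h *: 1]mulr1; case: (ltgtP h 0) h0 => // [hlt|hgt] _.
    have ht : h + t < t by lra.
    have [c] := MVT ht (fun x _ => dphi x) (continuous_subspaceT cphi).
    rewrite in_itv /= => /andP[c1 c2] E; exists c.
      rewrite gtr0_norm ?subr_gt0//; rewrite ltr0_norm// in hd'; lra.
    by rewrite -[LHS]opprB E; ring.
  have ht : t < h + t by lra.
  have [c] := MVT ht (fun x _ => dphi x) (continuous_subspaceT cphi).
  rewrite in_itv /= => /andP[c1 c2] E; exists c.
    rewrite ltr0_norm ?subr_lt0//; rewrite gtr0_norm// in hd'; lra.
  by rewrite E; ring.
have c1 := continuous_slice (t := t) cF.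
have c2 := continuous_slice (t := h *: 1 + t) cF.
have c3 := continuous_slice (t := t) cDF.
have c4 : continuous (fun u => F (cons_rV (h *: 1 + t) u) - F (cons_rV t u)).
  exact: ctsB.
have c5 : continuous (fun u => h^-1 * (F (cons_rV (h *: 1 + t) u) - F (cons_rV t u))).
  by apply: ctsM => //; exact: cts_cst.
rewrite /G -cube_integralB// [X in _ - X]/(_ *: _) /= -cube_integralZ// -cube_integralB//.
apply: cube_integral_norm_le; first exact: ctsB.
move=> u uc; have [c cd ->] := mvt u.
rewrite mulKf//; apply: ltW; exact: hd.
Unshelve. all: by end_near.
Qed.

(** For the outer variable this is the fundamental theorem of calculus, applied
    to the inner integral, which takes equal values at 0 and 1 by periodicity;
    the other variables are handled by induction, so the order of integration
    is never changed. *)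
Lemma cube_integral_deriv0 n (F : 'rV[R]_n -> R) k :
  continuous F -> (forall x, derivable F x (delta_mx 0 k)) ->
  continuous ('D_(delta_mx 0 k) F) ->
  (forall x, F (x + delta_mx 0 k) = F x) ->
  cube_integral ('D_(delta_mx 0 k) F) = 0.
Proof.
elim: n F k => [F []//|n IH F k]; case: (unliftP ord0 k) => [j ->|->] cF dF cDF pF /=.
- have E t u : (fun h : R => h^-1 *: (F (cons_rV t (h *: delta_mx 0 j + u)) - F (cons_rV t u))) =
      (fun h : R => h^-1 *: (F (h *: delta_mx 0 (lift ord0 j) + cons_rV t u) - F (cons_rV t u))).
    apply/funext => h; congr (_ *: (F _ - _)).
    by rewrite delta_consS cons_rVZ cons_rVD mulr0 add0r.
  have E' t : (fun u => 'D_(delta_mx 0 (lift ord0 j)) F (cons_rV t u)) =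
      'D_(delta_mx 0 j) (fun u => F (cons_rV t u)).
    by apply/funext => u; rewrite /derive /= E.
  rewrite (@eq_Rintegral _ _ _ _ _ (fun=> 0)); first by rewrite Rintegral_cst// mul0r.
  move=> t _; rewrite -[LHS]/(cube_integral (fun u => 'D_(delta_mx 0 (lift ord0 j)) F (cons_rV t u))).
  rewrite E' IH//.
  + exact: continuous_slice.
  + by move=> u; have := dF (cons_rV t u); rewrite /derivable /= E.
  + by have := continuous_slice (t := t) cDF; rewrite E'.
  + by move=> u; rewrite -(pF (cons_rV _ u)) delta_consS cons_rVD addr0.
- have dG t := cube_integral_is_derive t cF dF cDF.
  have cG := continuous_cube_integral cF.
  rewrite /Rintegral (@continuous_FTC2 R _ (fun t => cube_integral (fun u => F (cons_rV t u))) 0 1)//=.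
  + rewrite (_ : (fun u => F (cons_rV 1 u)) = (fun u => F (cons_rV 0 u))) ?subrr//.
    apply/funext => u; rewrite -(pF (cons_rV 0 u)) delta_cons0 cons_rVD.
    by rewrite add0r addr0.
  + exact: continuous_subspaceT (continuous_cube_integral cDF).
  + split.
    * by move=> x _; exact: ex_derive.
    * by apply: cvg_at_right_filter; exact: cG.
    * by apply: cvg_at_left_filter; exact: cG.
  + by move=> x _; rewrite derive1E; exact: derive_val.
Qed.

End DerivUnderIntegral.

(** * Trigonometric uniqueness in one variable *)

Section Uniqueness1D.
Context {R : realType}.
Let mu := @lebesgue_measure R.

Local Notation "\int01 f" := (\int[@lebesgue_measure R]_(t in `[0, 1]) f t)
  (at level 10, f at level 8).

Lemma int01D (f g : R -> R) : continuous f -> continuous g ->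
  \int01 (fun t => f t + g t) = \int01 f + \int01 g.
Proof. by move=> cf cg; rewrite RintegralD//; exact: continuous_integrable01. Qed.

Lemma int01Z c (f : R -> R) : continuous f -> \int01 (fun t => c * f t) = c * \int01 f.
Proof. by move=> cf; rewrite RintegralZl//; exact: continuous_integrable01. Qed.

Lemma int01_cst (c : R) : \int01 (fun=> c) = c.
Proof. exact: (@cube_integral_cst R 1 c). Qed.

(** Bounds from below the mass that the kernel powers concentrate near a point. *)
Lemma int01_lower (f : R -> R) a b c : continuous f -> 0 <= a -> a <= b -> b <= 1 ->
  0 <= c -> {in `[0, 1], forall t, 0 <= f t} -> {in `[a, b], forall t, c <= f t} ->
  c * (b - a) <= \int01 f.
Proof.
move=> cf a0 ab b1 c0 f0 fc.
have If := continuous_integrable01 cf.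
have mf := measurable_int _ If.
have sub : [set` `[a, b]] `<=` [set` `[0, 1]].
  by apply: subset_itv; rewrite bnd_simp.
rewrite -lee_fin /Rintegral fineK; last exact: integrable_fin_num.
apply: (@le_trans _ _ (\int[mu]_(t in `[a, b]) (f t)%:E)%E); last first.
  by apply: ge0_subset_integral => // t /= t01; rewrite lee_fin; exact: f0.
rewrite (_ : (c * (b - a))%:E = (\int[mu]_(t in `[a, b]) (cst c%:E t))%E); last first.
  rewrite integral_cst//; rewrite [X in (_ * X)%E](_ : _ = (b - a)%:E) ?EFinM//.
  have := lebesgue_measure_itv `[a, b]; rewrite /= lte_fin.
  case: ltP => [_ -> //|ba ->].
  by have -> : a = b; [apply/eqP; rewrite eq_le ab ba|rewrite subrr].
by apply: ge0_le_integral => //; exact: (measurable_funS _ sub mf).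
Qed.

Definition orthogonal_to_trig (h : R -> R) := forall k : int,
  \int01 (fun t => h t * cos (2 * pi * (k%:~R * t))) = 0 /\
  \int01 (fun t => h t * sin (2 * pi * (k%:~R * t))) = 0.

Lemma continuous_cos_lin (c d : R) : continuous (fun t : R => cos (c * (d * t))).
Proof.
move=> t; apply: (@continuous_comp _ _ _ (fun t : R => c * (d * t)) cos).
  by apply: ctsM; [exact: cts_cst|apply: ctsM; [exact: cts_cst|move=> ?; exact: cvg_id]].
exact: continuous_cos.
Qed.

Lemma continuous_sin_lin (c d : R) : continuous (fun t : R => sin (c * (d * t))).
Proof.
move=> t; apply: (@continuous_comp _ _ _ (fun t : R => c * (d * t)) sin).
  by apply: ctsM; [exact: cts_cst|apply: ctsM; [exact: cts_cst|move=> ?; exact: cvg_id]].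
exact: continuous_sin.
Qed.

(** By the addition formulas, a product of the kernel with a sine or cosine is
    again a trigonometric polynomial.  Iterating, h stays orthogonal to every
    power of the kernel. *)
Lemma orthogonal_to_trigM (h : R -> R) c x : continuous h -> orthogonal_to_trig h ->
  orthogonal_to_trig (fun t => h t * (c + cos (2 * pi * (t - x)))).
Proof.
move=> ch oh k.
have E1 t : cos (2 * pi * (t - x)) = cos (2 * pi * (1%:~R * t)) * cos (2 * pi * x) +
    sin (2 * pi * (1%:~R * t)) * sin (2 * pi * x).
  by rewrite mul1r mulrBr cosB.
have [c0 s0] := oh k; have [cp sp] := oh (k + 1); have [cm sm] := oh (k - 1).
pose K := fun j : int => fun t : R => 2 * pi * (j%:~R * t).
have Kp t : K (k + 1) t = K k t + K 1 t by rewrite /K intrD; ring.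
have Km t : K (k - 1) t = K k t - K 1 t by rewrite /K intrD mulrNz; ring.
have hc j : continuous (fun t => h t * cos (K j t)) by apply: ctsM => //; exact: continuous_cos_lin.
have hs j : continuous (fun t => h t * sin (K j t)) by apply: ctsM => //; exact: continuous_sin_lin.
pose C := cos (2 * pi * x); pose S := sin (2 * pi * x).
have Zc (a : R) (f : R -> R) : continuous f -> continuous (fun t => a * f t).
  by move=> ?; apply: ctsM => //; exact: cts_cst.
have lin (a1 a2 a3 a4 a5 : R) (f1 f2 f3 f4 f5 : R -> R) : continuous f1 -> continuous f2 -> continuous f3 ->
    continuous f4 -> continuous f5 ->
    \int01 f1 = 0 -> \int01 f2 = 0 -> \int01 f3 = 0 -> \int01 f4 = 0 -> \int01 f5 = 0 ->
    \int01 (fun t => a1 * f1 t + (a2 * f2 t + (a3 * f3 t + (a4 * f4 t + a5 * f5 t)))) = 0.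
  move=> k1 k2 k3 k4 k5 i1 i2 i3 i4 i5.
  have c4 := Zc a4 _ k4; have c5 := Zc a5 _ k5.
  have c1 := Zc a1 _ k1; have c2 := Zc a2 _ k2; have c3 := Zc a3 _ k3.
  have c45 := ctsD c4 c5; have c345 := ctsD c3 c45; have c2345 := ctsD c2 c345.
  rewrite (int01D c1 c2345) (int01D c2 c345) (int01D c3 c45) (int01D c4 c5) !int01Z//.
  by rewrite i1 i2 i3 i4 i5 !mulr0 !addr0.
split.
- apply: (etrans _ (lin c (C / 2) (C / 2) (S / 2) (- S / 2) _ _ _ _ _ (hc k) (hc (k + 1)) (hc (k - 1))
    (hs (k + 1)) (hs (k - 1)) c0 cp cm sp sm)).
  apply: eq_Rintegral => t _; rewrite E1 !Kp !Km !cosD !sinD !cosN !sinN /C /S /K; by field.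
- apply: (etrans _ (lin c (C / 2) (C / 2) (- S / 2) (S / 2) _ _ _ _ _ (hs k) (hs (k + 1)) (hs (k - 1))
    (hc (k + 1)) (hc (k - 1)) s0 sp sm cp cm)).
  apply: eq_Rintegral => t _; rewrite E1 !Kp !Km !cosD !sinD !cosN !sinN /C /S /K; by field.
Qed.

Lemma bernoulli_ineq (q : R) N : 1 <= q -> 1 + N%:R * (q - 1) <= q ^+ N.
Proof.
move=> q1; elim: N => [|N IH]; first by rewrite mul0r addr0 expr0.
rewrite exprS -natr1.
have : 0 <= N%:R * ((q - 1) * (q - 1)) by rewrite mulr_ge0// mulr_ge0//; lra.
have : q * (1 + N%:R * (q - 1)) <= q * q ^+ N by rewrite ler_wpM2l//; lra.
lra.
Qed.

Lemma cos_2pi_anti (x y : R) : 0 <= x -> x <= y -> y <= 1 / 2 ->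
  cos (2 * pi * y) <= cos (2 * pi * x).
Proof.
move=> x0; rewrite le_eqVlt => /orP[/eqP -> //|xy] y2; apply: ltW.
have pi0 := @pi_gt0 R.
have px : 0 <= pi * x by rewrite mulr_ge0// ltW.
have pxy : pi * x < pi * y by rewrite ltr_pM2l.
have py : pi * y <= pi * (1 / 2) by rewrite ler_pM2l.
by rewrite ltr_cos ?in_itv /=; [|apply/andP; split|apply/andP; split]; lra.
Qed.

Lemma cos_2pi_strict (d : R) : 0 < d -> d <= 1 / 2 ->
  cos (2 * pi * d) < cos (2 * pi * (d / 2)).
Proof.
move=> d0 d12; have pi0 := @pi_gt0 R.
have pd : 0 < pi * d by rewrite mulr_gt0.
have pd2 : pi * d <= pi * (1 / 2) by rewrite ler_pM2l.
by rewrite ltr_cos ?in_itv /=; [|apply/andP; split|apply/andP; split]; lra.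
Qed.

(** Beyond a half period the cosine is read off at the reflected point 1 - x. *)
Lemma cos_2pi_far (d x : R) : 0 <= d -> d <= x -> x <= 1 - d ->
  cos (2 * pi * x) <= cos (2 * pi * d).
Proof.
move=> d0 dx xd; have [x2|/ltW x2] := leP x (1 / 2); first exact: cos_2pi_anti.
have -> : cos (2 * pi * x) = cos (2 * pi * (1 - x)).
  by rewrite -(cosN (_ * x)) -(cosD2pi (- _)) mulr2n; congr cos; ring.
by apply: cos_2pi_anti; lra.
Qed.

(** Suppose h t0 > 0.  For small d, the kernel
    K t = 1 - cos (2 pi d) + cos (2 pi (t - t0)) is at least 1 at distance at
    most d from t0, at least some q > 1 at distance at most d / 2, and at most 1
    in absolute value elsewhere on the unit interval.  So the integral of
    h * K^N, which is zero, is bounded below by a multiple of q^N minus a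
    constant, which is absurd for large N. *)
Lemma trig_uniqueness_le0 (h : R -> R) t0 : continuous h -> orthogonal_to_trig h ->
  0 < t0 -> t0 < 1 -> h t0 <= 0.
Proof.
move=> ch oh t00 t01; rewrite leNgt; apply/negP => h0.
have pi0 := @pi_gt0 R.
have h20 : 0 < h t0 / 2 by lra.
(* d <= t0 and d <= 1 - t0 keep the interval around t0 inside [0, 1]. *)
have [d [d0 dt0 dt1 hd]] : exists d, [/\ 0 < d, d <= t0, d <= 1 - t0 &
    forall t, `|t - t0| <= d -> h t0 / 2 <= h t].
  move/cvgrPdist_lt : (ch t0) => /(_ _ h20) /nbhs_ballP[d /= d0 hd].
  exists (Num.min (d / 2) (Num.min t0 (1 - t0))); split.
  - by rewrite !lt_min; apply/and3P; split=> //; lra.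
  - by rewrite !ge_min lexx ?orbT.
  - by rewrite !ge_min lexx ?orbT.
  - move=> t; rewrite !le_min => /andP[td _].
    have /hd : ball t0 d t by rewrite /ball /= distrC; lra.
    rewrite ltr_norml => /andP[]; lra.
have [M [M0 hM]] : exists M, 0 <= M /\ {in `[0, 1], forall t, `|h t| <= M}.
  have [c c01 hc] := @EVT_max R (fun t => `|h t|) 0 1 ler01
    (continuous_subspaceT (fun t => cvg_norm (ch t))).
  by exists `|h c|; split.
pose c := 1 - cos (2 * pi * d).
pose K t := c + cos (2 * pi * (t - t0)).
pose q := c + cos (2 * pi * (d / 2)).
have d12 : d <= 1 / 2 by lra.
have q1 : 1 < q by have := cos_2pi_strict d0 d12; rewrite /q /c; clear; lra.
have cosabs t : cos (2 * pi * (t - t0)) = cos (2 * pi * `|t - t0|).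
  by rewrite -cos_norm !normrM (ger0_norm (ltW pi0)) ger0_norm.
have Kin t : `|t - t0| <= d -> 1 <= K t.
  move=> td; rewrite /K cosabs; have := cos_2pi_anti (normr_ge0 _) td d12.
  by rewrite /c; clear; lra.
have d2 : d / 2 <= 1 / 2 by clear -d0 d12; lra.
have Kin2 t : `|t - t0| <= d / 2 -> q <= K t.
  by move=> td; rewrite /K cosabs lerD2l cos_2pi_anti.
have Kout t : t \in `[0, 1] -> d <= `|t - t0| -> `|K t| <= 1.
  rewrite in_itv /= => /andP[t0' t1'] td.
  have td1 : `|t - t0| <= 1 - d.
    by rewrite ler_norml; apply/andP; split; clear -t0' t1' dt0 dt1; lra.
  have := cos_2pi_far (ltW d0) td td1.
  have := cos_geN1 (2 * pi * `|t - t0|); have := cos_le1 (2 * pi * d).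
  by rewrite /K cosabs /c ler_norml => h1 h2 h3; clear -h1 h2 h3; apply/andP; split; lra.
have cK : continuous K.
  apply: ctsD; first exact: cts_cst.
  move=> t; apply: (@continuous_comp _ _ _ (fun t : R => 2 * pi * (t - t0)) cos).
    apply: ctsM; first exact: cts_cst.
    by apply: ctsB; [move=> ?; exact: cvg_id|exact: cts_cst].
  exact: continuous_cos.
have H N : continuous (fun t => h t * K t ^+ N) /\ orthogonal_to_trig (fun t => h t * K t ^+ N).
  elim: N => [|N [IH1 IH2]].
    by rewrite (_ : (fun t => _) = h)//; apply/funext => t; rewrite expr0 mulr1.
  rewrite (_ : (fun t => _) = (fun t => (h t * K t ^+ N) * K t)); last first.
    by apply/funext => t; rewrite exprSr mulrA.
  by split; [exact: ctsM|exact: orthogonal_to_trigM].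
(* The interval of half-width d / 2 around t0 has length d. *)
have bound N : h t0 / 2 * q ^+ N * d <= M.
  have [cN /(_ 0)[oN _]] := H N.
  have {oN} zN : \int01 (fun t => h t * K t ^+ N) = 0.
    rewrite -[RHS]oN; apply: eq_Rintegral => t _.
    by rewrite mul0r mulr0 cos0 mulr1.
  have cM : continuous (fun t => h t * K t ^+ N + M).
    by apply: ctsD => //; exact: cts_cst.
  have -> : M = \int01 (fun t => h t * K t ^+ N + M).
    rewrite int01D//; last exact: cts_cst.
    by rewrite zN add0r int01_cst.
  have -> : h t0 / 2 * q ^+ N * d =
      h t0 / 2 * q ^+ N * ((t0 + d / 2) - (t0 - d / 2)) by field.
  have q0 : 0 <= q by rewrite ltW// (lt_trans ltr01).
  apply: int01_lower => //; try by clear -d0 dt0 dt1; lra.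
  - by rewrite mulr_ge0 ?exprn_ge0// ltW.
  - move=> t t01'; have [td|/ltW td] := leP `|t - t0| d.
      rewrite addr_ge0// mulr_ge0 ?exprn_ge0//; first exact: le_trans (ltW h20) (hd _ td).
      exact: le_trans ler01 (Kin _ td).
    have : `|h t * K t ^+ N| <= M.
      rewrite normrM normrX (le_trans _ (hM _ t01'))// ler_piMr//.
      by rewrite exprn_ile1// Kout.
    by rewrite ler_norml => /andP[]; rewrite -subr_ge0 opprK addrC.
  - move=> t; rewrite in_itv /= => /andP[t1 t2].
    have td : `|t - t0| <= d / 2.
      by rewrite ler_norml; apply/andP; split; clear -t1 t2; lra.
    have td' : `|t - t0| <= d by apply: le_trans td _; clear -d0; lra.
    have hK : h t0 / 2 * q ^+ N <= h t * K t ^+ N.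
      apply: ler_pM; rewrite ?exprn_ge0//; [exact: ltW|exact: hd|].
      rewrite lerXn2r ?nnegrE ?Kin2//.
      exact: le_trans q0 (Kin2 _ td).
    by apply: le_trans hK _; rewrite lerDl.
have hd0 : 0 < h t0 / 2 * d by rewrite mulr_gt0.
have := bound (Num.bound (M / (h t0 / 2 * d * (q - 1)))).
(* Bernoulli makes the lower bound exceed M for this exponent. *)
set N := Num.bound _.
have q10 : 0 < q - 1 by lra.
have : M / (h t0 / 2 * d * (q - 1)) < N%:R.
  by apply: archi_boundP; rewrite divr_ge0// ltW// mulr_gt0.
rewrite ltr_pdivrMr ?mulr_gt0// => MN.
have := bernoulli_ineq N (ltW q1) => /(ler_wpM2l (ltW hd0)).
lra.
Qed.

(** At interior points this is [trig_uniqueness_le0] for h and -h; the endpoints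
    follow by continuity. *)
Lemma trig_uniqueness (h : R -> R) : continuous h -> orthogonal_to_trig h ->
  {in `[0, 1], forall t, h t = 0}.
Proof.
move=> ch oh.
have inner t : 0 < t -> t < 1 -> h t = 0.
  move=> t0 t1; apply/eqP; rewrite eq_le trig_uniqueness_le0//=.
  rewrite -oppr_le0 -mulN1r; apply: (@trig_uniqueness_le0 (fun t => -1 * h t)) => //.
  - by apply: ctsM => //; exact: cts_cst.
  - move=> k; have [cc0 ss0] := oh k.
    have Z (f : R -> R) : continuous f -> \int01 f = 0 -> \int01 (fun t => -1 * f t) = 0.
      by move=> cf f0; rewrite int01Z// f0 mulr0.
    split.
      apply: (etrans _ (Z _ _ cc0)); last by apply: ctsM => //; exact: continuous_cos_lin.
      by apply: eq_Rintegral => x _; rewrite -[LHS]mulrA.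
    apply: (etrans _ (Z _ _ ss0)); last by apply: ctsM => //; exact: continuous_sin_lin.
    by apply: eq_Rintegral => x _; rewrite -[LHS]mulrA.

move=> t; rewrite in_itv /= => /andP[t0 t1].
apply/eqP/negPn/negP => ht.
have hp : 0 < `|h t| by rewrite normr_gt0.
move/cvgrPdist_lt : (ch t) => /(_ _ hp) /nbhs_ballP[d /= d0 hd].
have e0 : 0 < Num.min (d / 2) (1 / 2) by rewrite lt_min; apply/andP; split; lra.
have e1 : Num.min (d / 2) (1 / 2) <= 1 / 2 by rewrite ge_min lexx orbT.
have e2 : Num.min (d / 2) (1 / 2) <= d / 2 by rewrite ge_min lexx.
move: (Num.min _ _) e0 e1 e2 => e e0 e1 e2.
have p1 : 0 <= t * (1 - e) by rewrite mulr_ge0//; lra.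
have p2 : 0 <= (1 - t) * (1 - e) by rewrite mulr_ge0//; lra.
have p3 : 0 <= t * e by rewrite mulr_ge0//; lra.
have p4 : 0 <= (1 - t) * e by rewrite mulr_ge0//; lra.
have /hd : ball t d (t + e * (1 / 2 - t)).
  by rewrite /ball /= opprD addrA subrr sub0r normrN ltr_norml; apply/andP; split; lra.
by rewrite /= (inner (t + _)) ?subr0 ?ltxx//; lra.
Qed.

End Uniqueness1D.

(** * Trigonometric uniqueness on the cube *)

Section UniquenessCube.
Context {R : realType}.

Definition phase n (m : 'rV[int]_n) (u : 'rV[R]_n) : R :=
  2 * pi * \sum_i (m 0 i)%:~R * u 0 i.

Definition cons_int n (k : int) (m : 'rV[int]_n) : 'rV[int]_n.+1 :=
  \row_i (if unlift ord0 i is Some j then m 0 j else k).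

Lemma phase_cons n k (m : 'rV[int]_n) t u :
  phase (cons_int k m) (cons_rV t u) = 2 * pi * (k%:~R * t) + phase m u.
Proof.
rewrite /phase big_ord_recl [cons_int k m _ _]mxE unlift_none cons_rV0 mulrDr; congr (_ + _ * _).
by apply: eq_bigr => i _; rewrite [cons_int k m _ _]mxE liftK cons_rVS.
Qed.

Lemma continuous_phase n (m : 'rV[int]_n) : continuous (phase m).
Proof.
apply: ctsM; first exact: cts_cst.
apply: cts_sum => i _; apply: ctsM; first exact: cts_cst.
by move=> u; exact: coord_continuous.
Qed.

Lemma continuous_cos_phase n (m : 'rV[int]_n) : continuous (fun u => cos (phase m u)).
Proof.
move=> u; apply: (@continuous_comp _ _ _ (phase m) cos); first exact: continuous_phase.
exact: continuous_cos.
Qed.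

Lemma continuous_sin_phase n (m : 'rV[int]_n) : continuous (fun u => sin (phase m u)).
Proof.
move=> u; apply: (@continuous_comp _ _ _ (phase m) sin); first exact: continuous_phase.
exact: continuous_sin.
Qed.

(** Fix the frequencies in all variables but the first.  The partial Fourier
    coefficient is then a continuous function of the first variable, orthogonal
    to all trigonometric polynomials, because a product of two cosines or sines
    is a combination of phases with frequencies k and -k; so it vanishes.  Hence
    each slice of f satisfies the induction hypothesis. *)
Lemma cube_uniqueness n (f : 'rV[R]_n -> R) : continuous f ->
  (forall m : 'rV[int]_n,
     cube_integral (fun u => f u * cos (phase m u)) = 0 /\
     cube_integral (fun u => f u * sin (phase m u)) = 0) ->
  forall u, cube u -> f u = 0.
Proof.
elim: n f => [f cf|n IH f cf of0 u].
  have p0 m u : @phase 0 m u = 0 by rewrite /phase big_ord0 mulr0.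
  move=> f0 u _; have [+ _] := f0 0; rewrite /cube_integral p0 cos0 mulr1 => <-.
  by congr f; apply/rowP => -[].
pose P m u := f u * cos (phase m u); pose Q m u := f u * sin (phase m u).
have cP m : continuous (P m) by apply: ctsM => //; exact: continuous_cos_phase.
have cQ m : continuous (Q m) by apply: ctsM => //; exact: continuous_sin_phase.
have comb (a b : R) (F G : 'rV[R]_n.+1 -> R) : continuous F -> continuous G ->
    cube_integral F = 0 -> cube_integral G = 0 ->
    cube_integral (fun x => a * F x + b * G x) = 0.
  move=> cF cG F0 G0; rewrite cube_integralD ?cube_integralZ//.
  - by rewrite F0 G0 !mulr0 addr0.
  - by apply: ctsM => //; exact: cts_cst.
  - by apply: ctsM => //; exact: cts_cst.
have slice0 m' t : t \in `[0, 1] ->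
    cube_integral (fun u => f (cons_rV t u) * cos (phase m' u)) = 0 /\
    cube_integral (fun u => f (cons_rV t u) * sin (phase m' u)) = 0.
  have cl n' (c : R) (F : 'rV[R]_n' -> R) : continuous F -> cube_integral F * c =
      cube_integral (fun x => F x * c).
    move=> cF; rewrite mulrC -cube_integralZ//.
    by congr cube_integral; apply/funext => x; rewrite mulrC.
  have csl s : continuous (fun u => f (cons_rV s u) * cos (phase m' u)).
    by apply: ctsM; [exact: continuous_slice|exact: continuous_cos_phase].
  have ssl s : continuous (fun u => f (cons_rV s u) * sin (phase m' u)).
    by apply: ctsM; [exact: continuous_slice|exact: continuous_sin_phase].
  pose tl (x : 'rV[R]_n.+1) : 'rV[R]_n := \row_i x 0 (lift ord0 i).
  have ctl : continuous tl.
    move=> x; apply: (@cvg_rV R _ _ (nbhs_filter x)) => i; rewrite mxE.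
    under eq_cvg do rewrite mxE.
    exact: coord_continuous.
  have tlK s v : tl (cons_rV s v) = v by apply/rowP => i; rewrite mxE cons_rVS.
  have cc : continuous (fun s => cube_integral (fun u => f (cons_rV s u) * cos (phase m' u))).
    have /continuous_cube_integral : continuous (fun x => f x * cos (phase m' (tl x))).
      apply: ctsM => // x; apply: (@continuous_comp _ _ _ tl (fun u => cos (phase m' u))).
        exact: ctl.
      exact: continuous_cos_phase.
    by under eq_fun do under eq_fun do rewrite tlK.
  have sc : continuous (fun s => cube_integral (fun u => f (cons_rV s u) * sin (phase m' u))).
    have /continuous_cube_integral : continuous (fun x => f x * sin (phase m' (tl x))).
      apply: ctsM => // x; apply: (@continuous_comp _ _ _ tl (fun u => sin (phase m' u))).
        exact: ctl.
      exact: continuous_sin_phase.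
    by under eq_fun do under eq_fun do rewrite tlK.
  have iE (F : 'rV[R]_n.+1 -> R) (G : R -> R) : (forall s, cube_integral (fun u => F (cons_rV s u)) = G s) ->
      cube_integral F = 0 -> \int[@lebesgue_measure R]_(s in `[0, 1]) G s = 0.
    by move=> FG F0; rewrite -[RHS]F0 /=; apply: eq_Rintegral => s _; rewrite -FG.
  move=> t01; split.
  - apply: (trig_uniqueness cc _ t01) => k; split; [apply: (iE _ _ _ (comb (1 / 2) (1 / 2) _ _ (cP (cons_int k m')) (cP (cons_int (- k) m'))
        (of0 _).1 (of0 _).1))
      |apply: (iE _ _ _ (comb (1 / 2) (- (1 / 2)) _ _ (cQ (cons_int k m')) (cQ (cons_int (- k) m'))
        (of0 _).2 (of0 _).2))] => s;
    rewrite cl//; congr cube_integral; apply/funext => v;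
    rewrite /P /Q !phase_cons !mulrNz !(mulNr, mulrN) !(cosD, sinD, cosN, sinN); by field.
  - apply: (trig_uniqueness sc _ t01) => k; split; [apply: (iE _ _ _ (comb (1 / 2) (1 / 2) _ _ (cQ (cons_int k m')) (cQ (cons_int (- k) m'))
        (of0 _).2 (of0 _).2))
      |apply: (iE _ _ _ (comb (- (1 / 2)) (1 / 2) _ _ (cP (cons_int k m')) (cP (cons_int (- k) m'))
        (of0 _).1 (of0 _).1))] => s;
    rewrite cl//; congr cube_integral; apply/funext => v;
    rewrite /P /Q !phase_cons !mulrNz !(mulNr, mulrN) !(cosD, sinD, cosN, sinN); by field.
move=> uc; rewrite (cons_rV_surj u).
apply: (IH (fun v => f (cons_rV (u 0 0) v))).
- exact: continuous_slice.
- by move=> m'; apply: slice0; exact: uc.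
- by move=> i; rewrite mxE; exact: uc.
Qed.

End UniquenessCube.

(** * Smooth and continuously differentiable functions *)

Section SmoothFunctions.
Context {R : realType} {n : nat}.
Implicit Types (f g : 'rV[R]_n -> R) (j : 'I_n).

Lemma derive_rV f x v : differentiable f x ->
  'D_v f x = \sum_j v 0 j * pderiv j f x.
Proof.
move=> df; rewrite deriveE// {1}[v]row_sum_delta linear_sum.
by apply: eq_bigr => j _; rewrite linearZ /= /pderiv deriveE.
Qed.

Lemma pderivD j f g x : differentiable f x -> differentiable g x ->
  pderiv j (fun x => f x + g x) x = pderiv j f x + pderiv j g x.
Proof. by move=> df dg; rewrite /pderiv deriveD//; exact: diff_derivable. Qed.

Lemma pderivB j f g x : differentiable f x -> differentiable g x ->
  pderiv j (fun x => f x - g x) x = pderiv j f x - pderiv j g x.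
Proof. by move=> df dg; rewrite /pderiv deriveB//; exact: diff_derivable. Qed.

Lemma pderivM j f g x : differentiable f x -> differentiable g x ->
  pderiv j (fun x => f x * g x) x = pderiv j f x * g x + f x * pderiv j g x.
Proof.
move=> df dg; rewrite /pderiv deriveM; [|exact: diff_derivable..].
by rewrite addrC [g x *: _]mulrC.
Qed.

Lemma pderivZ j c f x : differentiable f x ->
  pderiv j (fun x => c * f x) x = c * pderiv j f x.
Proof. by move=> df; rewrite /pderiv deriveZ//; exact: diff_derivable. Qed.

Lemma pderiv_cst j c x : pderiv j (fun=> c : R) x = 0.
Proof. by rewrite /pderiv derive_cst. Qed.

(** Differentiability plus continuity of the partial derivatives is all that
    integration by parts uses, and it is clearly stable under products. *)
Definition C1 f := (forall x, differentiable f x) /\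
  forall j, continuous (pderiv j f).

Lemma C1_continuous f : C1 f -> continuous f.
Proof. by move=> [df _] x; exact: differentiable_continuous. Qed.

Lemma C1D f g : C1 f -> C1 g -> C1 (fun x => f x + g x).
Proof.
move=> [df cf] [dg cg]; split=> [x|j]; first exact: differentiableD.
rewrite (_ : pderiv j _ = fun x => pderiv j f x + pderiv j g x).
  exact: ctsD.
by apply/funext => x; rewrite pderivD.
Qed.

Lemma C1B f g : C1 f -> C1 g -> C1 (fun x => f x - g x).
Proof.
move=> [df cf] [dg cg]; split=> [x|j]; first exact: differentiableB.
rewrite (_ : pderiv j _ = fun x => pderiv j f x - pderiv j g x).
  exact: ctsB.
by apply/funext => x; rewrite pderivB.
Qed.

Lemma C1M f g : C1 f -> C1 g -> C1 (fun x => f x * g x).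
Proof.
move=> Cf Cg; have [df cf] := Cf; have [dg cg] := Cg.
split=> [x|j]; first exact: differentiableM.
rewrite (_ : pderiv j _ = fun x => pderiv j f x * g x + f x * pderiv j g x).
  by apply: ctsD; apply: ctsM => //; exact: C1_continuous.
by apply/funext => x; rewrite pderivM.
Qed.

Lemma smooth_coind (S : set ('rV[R]_n -> R)) :
  (forall f, S f -> forall x, differentiable f x) ->
  (forall f j, S f -> S (pderiv j f)) -> S `<=` smooth.
Proof.
move=> dS pS f Sf s; apply: dS.
by elim: s => [//|j s IH] /=; exact: pS.
Qed.

Lemma smooth_differentiable f x : smooth f -> differentiable f x.
Proof. by move=> /(_ [::]). Qed.

Lemma smooth_pderiv j f : smooth f -> smooth (pderiv j f).
Proof. by move=> sf s x; have := sf (rcons s j) x; rewrite foldr_rcons. Qed.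

Lemma smooth_C1 f : smooth f -> C1 f.
Proof.
move=> sf; split=> [x|j x]; first exact: smooth_differentiable.
by apply/differentiable_continuous/smooth_differentiable; exact: smooth_pderiv.
Qed.

Lemma smoothD f g : smooth f -> smooth g -> smooth (fun x => f x + g x).
Proof.
move=> sf sg; apply: (@smooth_coind [set h | exists f g, [/\ smooth f, smooth g &
    h = fun x => f x + g x]]); last by exists f, g.
  move=> _ [f' [g' [sf' sg' ->]]] x.
  by apply: differentiableD; exact: smooth_differentiable.
move=> _ j [f' [g' [sf' sg' ->]]]; exists (pderiv j f'), (pderiv j g').
split; [exact: smooth_pderiv|exact: smooth_pderiv|].
by apply/funext => x; rewrite pderivD//; exact: smooth_differentiable.
Qed.

Lemma smoothZ c f : smooth f -> smooth (fun x => c * f x).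
Proof.
move=> sf; apply: (@smooth_coind [set h | exists2 f, smooth f & h = fun x => c * f x]).
- move=> _ [g sg ->] x; apply: differentiableM; last exact: smooth_differentiable.
  exact: differentiable_cst.
- move=> _ j [g sg ->]; exists (pderiv j g); first exact: smooth_pderiv.
  by apply/funext => x; rewrite pderivZ//; exact: smooth_differentiable.
- by exists f.
Qed.

Lemma smooth_cst c : smooth (fun _ : 'rV[R]_n => c).
Proof.
apply: (@smooth_coind [set h | exists c, h = fun=> c]); last by exists c.
- by move=> _ [d ->] x; exact: differentiable_cst.
- by move=> _ j [d ->]; exists 0; apply/funext => x; rewrite pderiv_cst.
Qed.

Lemma differentiable_trig (theta : 'rV[R]_n -> R) a b x :
  differentiable theta x ->
  differentiable (fun x => a * cos (theta x) + b * sin (theta x)) x.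
Proof.
move=> dt; have dc : differentiable (fun x => cos (theta x)) x.
  apply: (@differentiable_comp _ _ _ _ theta cos) => //.
  by apply/derivable1_diffP; exact: derivable_cos.
have ds : differentiable (fun x => sin (theta x)) x.
  apply: (@differentiable_comp _ _ _ _ theta sin) => //.
  by apply/derivable1_diffP; exact: derivable_sin.
by apply: differentiableD; apply: differentiableM => //; exact: differentiable_cst.
Qed.

Lemma pderiv_comp j (h : R -> R) dh (theta : 'rV[R]_n -> R) x :
  differentiable theta x -> is_derive (theta x) 1 h dh ->
  pderiv j (fun x => h (theta x)) x = dh * pderiv j theta x.
Proof.
move=> dt ih; have dht : differentiable h (theta x).
  by apply/derivable1_diffP; exact: ex_derive.
rewrite /pderiv deriveE; last exact: (@differentiable_comp _ _ _ _ theta h).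
rewrite -[fun x => _]/(h \o theta) diff_comp//= -(deriveE _ dt) diff1E//=.
by rewrite derive1E derive_val [LHS]mulrC.
Qed.

(** A phase with constant partial derivatives makes the combinations of its sine
    and cosine a class stable under partial derivatives. *)
Lemma smooth_trig (theta : 'rV[R]_n -> R) (c : 'I_n -> R) a b :
  (forall x, differentiable theta x) -> (forall j x, pderiv j theta x = c j) ->
  smooth (fun x => a * cos (theta x) + b * sin (theta x)).
Proof.
move=> dt ct; apply: (@smooth_coind [set h | exists a b,
    h = fun x => a * cos (theta x) + b * sin (theta x)]); last by exists a, b.
- by move=> _ [a' [b' ->]] x; exact: differentiable_trig.
- move=> _ j [a' [b' ->]]; exists (b' * c j), (- (a' * c j)).
  apply/funext => x.
  have dc : differentiable (fun x => cos (theta x)) x.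
    apply: (@differentiable_comp _ _ _ _ theta cos) => //.
    by apply/derivable1_diffP; exact: derivable_cos.
  have ds : differentiable (fun x => sin (theta x)) x.
    apply: (@differentiable_comp _ _ _ _ theta sin) => //.
    by apply/derivable1_diffP; exact: derivable_sin.
  rewrite pderivD; [|by apply: differentiableM => //; exact: differentiable_cst..].
  rewrite !pderivZ// (pderiv_comp j (dt x) (is_derive_cos _)).
  by rewrite (pderiv_comp j (dt x) (is_derive_sin _)) ct; ring.
Qed.

End SmoothFunctions.

(** * The integral of a periodic function *)

Section TorusIntegral.
Context {R : realType} {n : nat} (B : 'M[R]_n) (hB : B \in unitmx).
Implicit Types (f g : 'rV[R]_n -> R).

Definition periodic T (f : 'rV[R]_n -> T) := forall x v, lattice B v -> f (x + v) = f x.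

Lemma continuous_mulmx m (A : 'M[R]_(m, n)) : continuous (fun u : 'rV[R]_m => u *m A).
Proof.
move=> u; apply: (@cvg_rV R _ _ (nbhs_filter u)) => i.
rewrite mxE; under eq_cvg do rewrite mxE.
apply: (@cts_sum _ _ _ _ _ (fun k (u : 'rV[R]_m) => u 0 k * A k i)) => k _.
by apply: ctsM; [move=> ?; exact: coord_continuous|exact: cts_cst].
Qed.

Lemma continuous_mulmx_comp f : continuous f -> continuous (fun u : 'rV[R]_n => f (u *m B)).
Proof.
move=> cf u; apply: (@continuous_comp _ _ _ (fun u : 'rV[R]_n => u *m B) f); last exact: cf.
exact: continuous_mulmx.
Qed.

Lemma torus_integralD f g : continuous f -> continuous g ->
  torus_integral B (fun x => f x + g x) = torus_integral B f + torus_integral B g.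
Proof.
move=> cf cg; rewrite /torus_integral -mulrDr cube_integralD//; exact: continuous_mulmx_comp.
Qed.

Lemma torus_integralZ c f : continuous f ->
  torus_integral B (fun x => c * f x) = c * torus_integral B f.
Proof.
by move=> cf; rewrite /torus_integral cube_integralZ 1?mulrCA//; exact: continuous_mulmx_comp.
Qed.

Lemma torus_integralB f g : continuous f -> continuous g ->
  torus_integral B (fun x => f x - g x) = torus_integral B f - torus_integral B g.
Proof.
move=> cf cg; rewrite /torus_integral -mulrBr cube_integralB//; exact: continuous_mulmx_comp.
Qed.

Lemma torus_integral_cst c : torus_integral B (fun=> c) = `|\det B| * c.
Proof. by rewrite /torus_integral cube_integral_cst. Qed.

Lemma lattice_row k : lattice B (delta_mx 0 k *m B).
Proof.
exists (delta_mx 0 k) => //; congr (_ *m _).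
by apply/rowP => i; rewrite !mxE; case: (_ && _).
Qed.

(** In the coordinates given by the lattice basis, the integrand becomes a
    linear combination of partial derivatives of a function that is 1-periodic
    in each variable. *)
Lemma torus_integral_pderiv f j : C1 f -> periodic f ->
  torus_integral B (pderiv j f) = 0.
Proof.
move=> Cf pf; have [df cf] := Cf.
have E k u : (fun h : R => h^-1 *: (f ((h *: delta_mx 0 k + u) *m B) - f (u *m B))) =
    (fun h : R => h^-1 *: (f (h *: (delta_mx 0 k *m B) + u *m B) - f (u *m B))).
  by apply/funext => h; rewrite mulmxDl scalemxAl.
have DE k : 'D_(delta_mx 0 k) (fun u => f (u *m B)) =
    fun u => \sum_l B k l * pderiv l f (u *m B).
  apply/funext => u; rewrite {1}/derive /= E -/(derive f (u *m B) (delta_mx 0 k *m B)).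
  rewrite derive_rV//; apply: eq_bigr => l _.
  by rewrite -rowE mxE.
have cD k : continuous (fun u : 'rV[R]_n => \sum_l B k l * pderiv l f (u *m B)).
  apply: cts_sum => l _; apply: ctsM; first exact: cts_cst.
  exact: (@continuous_mulmx_comp (pderiv l f)).
have I0 k : cube_integral (fun u => \sum_l B k l * pderiv l f (u *m B)) = 0.
  rewrite -DE; apply: cube_integral_deriv0.
  - by apply: continuous_mulmx_comp; exact: C1_continuous.
  - move=> u; rewrite /derivable /= E.
    have : derivable f (u *m B) (delta_mx 0 k *m B) by exact: diff_derivable.
    exact.
  - by rewrite DE; exact: cD.
  - by move=> u; rewrite mulmxDl pf//; exact: lattice_row.
rewrite /torus_integral.
rewrite (_ : (fun u => _) =
    (fun u => \sum_k invmx B j k * \sum_l B k l * pderiv l f (u *m B))).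
  rewrite cube_integral_sum; last by move=> k; apply: ctsM; [exact: cts_cst|exact: cD].
  rewrite big1 ?mulr0// => k _; rewrite cube_integralZ; last exact: cD.
  by rewrite I0 mulr0.
apply/funext => u; under eq_bigr do rewrite big_distrr /=; rewrite exchange_big /=.
under eq_bigr => l _.
  under eq_bigr do rewrite mulrA.
  rewrite -big_distrl /=.
  have -> : \sum_k invmx B j k * B k l = (j == l)%:R.
    by have /matrixP/(_ j l) := mulVmx hB; rewrite !mxE.
  over.
rewrite (bigD1 j)//= eqxx mul1r big1 ?addr0// => l /negPf.
by rewrite eq_sym => ->; rewrite mul0r.
Qed.

End TorusIntegral.

(** * Complex-valued functions and integration by parts *)

Section ComplexFunctions.
Context {R : realType}.
Local Notation C := R[i].
Local Notation Re := (@complex.Re R).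
Local Notation Im := (@complex.Im R).

Lemma ReD (x y : C) : Re (x + y) = Re x + Re y. Proof. by case: x y => [? ?] []. Qed.
Lemma ImD (x y : C) : Im (x + y) = Im x + Im y. Proof. by case: x y => [? ?] []. Qed.
Lemma ReM (x y : C) : Re (x * y) = Re x * Re y - Im x * Im y.
Proof. by case: x y => [? ?] []. Qed.
Lemma ImM (x y : C) : Im (x * y) = Re x * Im y + Im x * Re y.
Proof. by case: x y => [? ?] []. Qed.
Lemma Re_conj (x : C) : Re x^* = Re x. Proof. by case: x. Qed.
Lemma Im_conj (x : C) : Im x^* = - Im x. Proof. by case: x. Qed.
Lemma complex_eq (x y : C) : Re x = Re y -> Im x = Im y -> x = y.
Proof. by case: x y => [? ?] [? ?] /= -> ->. Qed.

Context {n : nat}.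
Implicit Types (f g : 'rV[R]_n -> C) (j : 'I_n).

Definition ccts f := continuous (Re \o f) /\ continuous (Im \o f).
Definition cC1 f := C1 (Re \o f) /\ C1 (Im \o f).

Lemma csmooth_cC1 f : csmooth f -> cC1 f.
Proof. by move=> [sr si]; split; exact: smooth_C1. Qed.

Lemma cC1_ccts f : cC1 f -> ccts f.
Proof. by move=> [cr ci]; split; exact: C1_continuous. Qed.

Lemma cC1_pderiv j f : cC1 f -> ccts (cpderiv j f).
Proof. by move=> [[_ cr] [_ ci]]; split; [exact: cr|exact: ci]. Qed.

Lemma ccts_cst c : ccts (fun=> c).
Proof. by rewrite /ccts /comp; split; exact: cts_cst. Qed.

Lemma cctsD f g : ccts f -> ccts g -> ccts (fun x => f x + g x).
Proof.
move=> [fr fi] [gr gi]; split.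
  rewrite (_ : _ \o _ = fun x => (Re \o f) x + (Re \o g) x); first exact: ctsD.
  by apply/funext => x /=; rewrite ReD.
rewrite (_ : _ \o _ = fun x => (Im \o f) x + (Im \o g) x); first exact: ctsD.
by apply/funext => x /=; rewrite ImD.
Qed.

Let ReME f g : Re \o (fun x => f x * g x) =
  fun x => (Re \o f) x * (Re \o g) x - (Im \o f) x * (Im \o g) x.
Proof. by apply/funext => x /=; rewrite ReM. Qed.

Let ImME f g : Im \o (fun x => f x * g x) =
  fun x => (Re \o f) x * (Im \o g) x + (Im \o f) x * (Re \o g) x.
Proof. by apply/funext => x /=; rewrite ImM. Qed.

Lemma cctsM f g : ccts f -> ccts g -> ccts (fun x => f x * g x).
Proof.
move=> [fr fi] [gr gi]; split; rewrite ?ReME ?ImME.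
  by apply: ctsB; exact: ctsM.
by apply: ctsD; exact: ctsM.
Qed.

Lemma ccts_sum (I : Type) (r : seq I) (P : pred I) (F : I -> 'rV[R]_n -> C) :
  (forall i, P i -> ccts (F i)) -> ccts (fun x => \sum_(i <- r | P i) F i x).
Proof.
move=> cF; elim: r => [|i r IH].
  by under eq_fun do rewrite big_nil; exact: ccts_cst.
case Pi: (P i); last by under eq_fun do rewrite big_cons Pi; exact: IH.
under eq_fun do rewrite big_cons Pi.
by apply: cctsD => //; exact: cF.
Qed.

Lemma cC1M f g : cC1 f -> cC1 g -> cC1 (fun x => f x * g x).
Proof.
move=> [fr fi] [gr gi]; split; rewrite ?ReME ?ImME.
  by apply: C1B; exact: C1M.
by apply: C1D; exact: C1M.
Qed.

Lemma cpderivM j f g x : cC1 f -> cC1 g ->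
  cpderiv j (fun x => f x * g x) x = cpderiv j f x * g x + f x * cpderiv j g x.
Proof.
move=> [fr fi] [gr gi]; rewrite /cpderiv ReME ImME.
have dM (h k : 'rV[R]_n -> R) : C1 h -> C1 k -> differentiable (fun x => h x * k x) x.
  by move=> h1 k1; have [dhk _] := C1M h1 k1.
rewrite pderivB ?pderivD ?pderivM//; try exact: dM;
  try solve [exact: fr.1|exact: fi.1|exact: gr.1|exact: gi.1].
by apply: complex_eq; rewrite ?ReD ?ImD ?ReM ?ImM /=; ring.
Qed.

Lemma cpderiv_conj j f x : cC1 f -> cpderiv j (fun x => (f x)^*) x = (cpderiv j f x)^*.
Proof.
move=> [fr fi]; rewrite /cpderiv.
have -> : Re \o (fun x => (f x)^*) = Re \o f by apply/funext => y /=; rewrite Re_conj.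
have -> : Im \o (fun x => (f x)^*) = (fun x => -1 * (Im \o f) x).
  by apply/funext => y /=; rewrite Im_conj mulN1r.
rewrite pderivZ; last exact: fi.1.
by apply: complex_eq; rewrite ?Re_conj ?Im_conj /= ?mulN1r.
Qed.

Lemma cC1_conj f : cC1 f -> cC1 (fun x => (f x)^*).
Proof.
move=> [fr fi]; split.
  by have -> : Re \o (fun x => (f x)^*) = Re \o f by apply/funext => y /=; rewrite Re_conj.
have -> : Im \o (fun x => (f x)^*) = (fun x => 0 - (Im \o f) x).
  by apply/funext => y /=; rewrite Im_conj sub0r.
exact: C1B (smooth_C1 (smooth_cst 0)) fi.
Qed.

Lemma csmooth_pderiv j f : csmooth f -> csmooth (cpderiv j f).
Proof. by move=> [fr fi]; split; exact: smooth_pderiv. Qed.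

Lemma csmooth_cst c : csmooth (fun _ : 'rV[R]_n => c).
Proof. by split; exact: smooth_cst. Qed.

Lemma csmoothD f g : csmooth f -> csmooth g -> csmooth (fun x => f x + g x).
Proof.
move=> [fr fi] [gr gi]; split.
  rewrite (_ : _ \o _ = fun x => (Re \o f) x + (Re \o g) x); first exact: smoothD.
  by apply/funext => x /=; rewrite ReD.
rewrite (_ : _ \o _ = fun x => (Im \o f) x + (Im \o g) x); first exact: smoothD.
by apply/funext => x /=; rewrite ImD.
Qed.

Lemma csmoothZ c f : csmooth f -> csmooth (fun x => c * f x).
Proof.
move=> [fr fi]; split.
  rewrite (_ : _ \o _ = fun x => Re c * (Re \o f) x + (- Im c) * (Im \o f) x).
    by apply: smoothD; exact: smoothZ.
  by apply/funext => x /=; rewrite ReM mulNr.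
rewrite (_ : _ \o _ = fun x => Re c * (Im \o f) x + Im c * (Re \o f) x).
  by apply: smoothD; exact: smoothZ.
by apply/funext => x /=; rewrite ImM.
Qed.

Lemma csmooth_sum (I : Type) (r : seq I) (P : pred I) (F : I -> 'rV[R]_n -> C) :
  (forall i, P i -> csmooth (F i)) -> csmooth (fun x => \sum_(i <- r | P i) F i x).
Proof.
move=> cF; elim: r => [|i r IH].
  by under eq_fun do rewrite big_nil; exact: csmooth_cst.
case Pi: (P i); last by under eq_fun do rewrite big_cons Pi; exact: IH.
under eq_fun do rewrite big_cons Pi.
by apply: csmoothD => //; exact: cF.
Qed.

Context (B : 'M[R]_n) (hB : B \in unitmx).
Local Notation CT := (torus_cintegral B).

Lemma torus_cintegralD f g : ccts f -> ccts g -> CT (fun x => f x + g x) = CT f + CT g.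
Proof.
move=> [fr fi] [gr gi]; apply: complex_eq; rewrite ?ReD ?ImD /=.
  rewrite -torus_integralD//; congr torus_integral.
  by apply/funext => x /=; rewrite ReD.
rewrite -torus_integralD//; congr torus_integral.
by apply/funext => x /=; rewrite ImD.
Qed.

Lemma torus_cintegralZ c f : ccts f -> CT (fun x => c * f x) = c * CT f.
Proof.
move=> [fr fi]; have Z a (h : 'rV[R]_n -> R) : continuous h -> continuous (fun x => a * h x).
  by move=> ?; apply: ctsM => //; exact: cts_cst.
apply: complex_eq; rewrite ?ReM ?ImM /= -!torus_integralZ// -?torus_integralB -?torus_integralD//;
  try exact: Z.
  by congr torus_integral; apply/funext => x /=; rewrite ReM.
by congr torus_integral; apply/funext => x /=; rewrite ImM.
Qed.

Lemma torus_cintegral_cst c : CT (fun=> c) = (`|\det B|)%:C%C * c.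
Proof.
apply: complex_eq; rewrite ?ReM ?ImM /= ?mul0r ?subr0 ?addr0 -torus_integral_cst//.
Qed.

Lemma torus_cintegral_sum (I : Type) (r : seq I) (P : pred I) (F : I -> 'rV[R]_n -> C) :
  (forall i, P i -> ccts (F i)) ->
  CT (fun x => \sum_(i <- r | P i) F i x) = \sum_(i <- r | P i) CT (F i).
Proof.
move=> cF; elim: r => [|i r IH].
  by under eq_fun do rewrite big_nil; rewrite big_nil torus_cintegral_cst mulr0.
rewrite big_cons; case Pi: (P i); last by under eq_fun do rewrite big_cons Pi; exact: IH.
under eq_fun do rewrite big_cons Pi.
by rewrite torus_cintegralD ?IH//; [exact: cF|exact: ccts_sum].
Qed.

Lemma torus_cintegral_cpderiv j f : cC1 f -> periodic B f -> CT (cpderiv j f) = 0.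
Proof.
move=> [fr fi] pf; apply: complex_eq => /=.
  by apply: torus_integral_pderiv => // x v vl /=; rewrite pf.
by apply: torus_integral_pderiv => // x v vl /=; rewrite pf.
Qed.

Lemma torus_cintegral_by_parts j f g : cC1 f -> cC1 g -> periodic B f -> periodic B g ->
  CT (fun x => cpderiv j f x * g x) = - CT (fun x => f x * cpderiv j g x).
Proof.
move=> cf cg pf pg; apply/eqP; rewrite -addr_eq0 -torus_cintegralD.
- rewrite -(@torus_cintegral_cpderiv j (fun x => f x * g x)); first last.
  + by move=> x v vl; rewrite pf// pg.
  + exact: cC1M.
  by apply/eqP; congr torus_cintegral; apply/funext => x; rewrite cpderivM.
- by apply: cctsM; [exact: cC1_pderiv|exact: cC1_ccts].
- by apply: cctsM; [exact: cC1_ccts|exact: cC1_pderiv].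
Qed.

End ComplexFunctions.

(** * Fourier modes and their completeness *)

Section Modes.
Context {R : realType} {n : nat} (B : 'M[R]_n) (hB : B \in unitmx).
Local Notation C := R[i].
Local Notation Re := (@complex.Re R).
Local Notation Im := (@complex.Im R).
Local Notation CT := (torus_cintegral B).
Implicit Types (f g : 'rV[R]_n -> C) (j : 'I_n) (m : 'rV[int]_n).

(** The frequency vectors are 2 pi times the points of the dual lattice, whose
    basis is the inverse transpose of B. *)
Definition freq m j : R := 2 * pi * \sum_i (m 0 i)%:~R * invmx B j i.

Definition theta m (x : 'rV[R]_n) : R := \sum_j x 0 j * freq m j.

Definition mode m (x : 'rV[R]_n) : C := (cos (theta m x) +i* sin (theta m x))%C.

Lemma freqE m j : freq m j = 2 * pi * (map_mx intr m *m (invmx B)^T) 0 j.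
Proof. by rewrite /freq mxE; congr (_ * _); apply: eq_bigr => i _; rewrite !mxE. Qed.

Lemma freqD m m' j : freq (m + m') j = freq m j + freq m' j.
Proof. by rewrite !freqE raddfD mulmxDl mxE mulrDr. Qed.

Lemma freqN m j : freq (- m) j = - freq m j.
Proof. by rewrite !freqE raddfN mulNmx mxE mulrN. Qed.

Lemma freq0 j : freq 0 j = 0.
Proof. by rewrite freqE raddf0 mul0mx mxE mulr0. Qed.

Lemma twopi_neq0 : 2 * pi != 0 :> R.
Proof. by rewrite mulf_neq0// gt_eqF// pi_gt0. Qed.

Lemma freq_eq0 m : (forall j, freq m j = 0) -> m = 0.
Proof.
move=> f0; have : map_mx intr m *m (invmx B)^T = 0 :> 'rV[R]_n.
  apply/rowP => j; rewrite [RHS]mxE; have := f0 j; rewrite freqE => /eqP.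
  by rewrite mulf_eq0 (negPf twopi_neq0) => /eqP.
move/(congr1 (fun v => v *m B^T)); rewrite mul0mx -mulmxA -trmx_mul mulmxV//.
rewrite trmx1 mulmx1 => m0; apply/rowP => i; move/rowP/(_ i) : m0.
by rewrite !mxE => /eqP; rewrite intr_eq0 => /eqP.
Qed.

Lemma thetaD m x y : theta m (x + y) = theta m x + theta m y.
Proof. by rewrite -big_split; apply: eq_bigr => j _; rewrite mxE mulrDl. Qed.

Lemma theta_add m m' x : theta (m + m') x = theta m x + theta m' x.
Proof. by rewrite -big_split; apply: eq_bigr => j _; rewrite freqD mulrDr. Qed.

Lemma theta_opp m x : theta (- m) x = - theta m x.
Proof. by rewrite /theta -sumrN; apply: eq_bigr => j _; rewrite freqN mulrN. Qed.

Lemma theta0 x : theta 0 x = 0.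
Proof. by rewrite /theta big1// => j _; rewrite freq0 mulr0. Qed.

Lemma theta_phase m u : theta m (u *m B) = phase m u.
Proof.
have E : theta m (u *m B) = 2 * pi * (map_mx intr m *m (invmx B)^T *m (u *m B)^T) 0 0.
  rewrite /theta mxE big_distrr; apply: eq_bigr => j _.
  by rewrite freqE [(u *m B)^T _ _]mxE /=; ring.
rewrite E trmx_mul -mulmxA (mulmxA (invmx B)^T) -trmx_mul mulmxV// trmx1 mul1mx.
by rewrite /phase mxE; congr (_ * _); apply: eq_bigr => i _; rewrite !mxE.
Qed.

Lemma differentiable_theta m x : differentiable (theta m) x.
Proof.
rewrite (_ : theta m = \sum_j (fun x : 'rV[R]_n => x 0 j * freq m j)); last first.
  by apply/funext => y; rewrite fct_sumE.
apply: differentiable_sum => j; apply: differentiableM.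
  exact: differentiable_coord.
exact: differentiable_cst.
Qed.

Lemma pderiv_theta j m x : pderiv j (theta m) x = freq m j.
Proof.
rewrite /pderiv /derive; apply/lim_near_cst => //=.
near=> h; rewrite thetaD addrK /theta (bigD1 j)//= big1 ?addr0.
  rewrite !mxE !eqxx mulr1 [_ *: _]mulrA mulVf ?mul1r//.
  by near: h; exact: nbhs_dnbhs_neq.
by move=> k /negPf kj; rewrite !mxE kj andbF mulr0 mul0r.
Unshelve. all: by end_near.
Qed.

Lemma csmooth_mode m : csmooth (mode m).
Proof.
split.
  have := @smooth_trig _ _ (theta m) (freq m) 1 0 (differentiable_theta m)
    (fun j => pderiv_theta j m).
  by congr smooth; apply/funext => x /=; rewrite mul1r mul0r addr0.
have := @smooth_trig _ _ (theta m) (freq m) 0 1 (differentiable_theta m)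
  (fun j => pderiv_theta j m).
by congr smooth; apply/funext => x /=; rewrite mul1r mul0r add0r.
Qed.

Lemma cpderiv_mode j m x : cpderiv j (mode m) x = (0 +i* freq m j)%C * mode m x.
Proof.
have dt := differentiable_theta m x.
rewrite /cpderiv; have -> : Re \o mode m = fun x => cos (theta m x) by [].
have -> : Im \o mode m = fun x => sin (theta m x) by [].
rewrite (pderiv_comp j dt (is_derive_cos _)) (pderiv_comp j dt (is_derive_sin _)).
by rewrite pderiv_theta; apply: complex_eq; rewrite ?ReM ?ImM /=; ring.
Qed.

Lemma mode_add m m' x : mode (m + m') x = mode m x * mode m' x.
Proof.
by apply: complex_eq; rewrite ?ReM ?ImM /= theta_add ?cosD ?sinD; ring.
Qed.

Lemma mode0 x : mode 0 x = 1.
Proof. by rewrite /mode theta0 cos0 sin0. Qed.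

Lemma mode_conj m x : (mode m x)^* = mode (- m) x.
Proof. by apply: complex_eq; rewrite ?Re_conj ?Im_conj /= theta_opp ?cosN ?sinN. Qed.

Lemma cos_sin_2pi_int (x : R) (k : int) :
  cos (x + 2 * pi * k%:~R) = cos x /\ sin (x + 2 * pi * k%:~R) = sin x.
Proof.
have N (N : nat) (y : R) : cos (y + 2 * pi * N%:R) = cos y /\ sin (y + 2 * pi * N%:R) = sin y.
  elim: N => [|N [<- <-]]; first by rewrite mulr0 addr0.
  have -> : y + 2 * pi * N.+1%:R = y + 2 * pi * N%:R + pi *+ 2.
    by rewrite -natr1 mulr2n; ring.
  by rewrite cosD2pi sinD2pi.
case: k => k; first exact: N.
rewrite NegzE mulrNz mulrN; have [<- <-] := N k.+1 (x - 2 * pi * k.+1%:R).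
by rewrite subrK.
Qed.

Lemma periodic_mode m : periodic B (mode m).
Proof.
move=> x v [z _ <-]; rewrite /mode thetaD theta_phase.
have -> : phase m (map_mx intr z) = 2 * pi * (\sum_i m 0 i * z 0 i)%:~R :> R.
  rewrite /phase (raddf_sum (intr : int -> R)); congr (_ * _); apply: eq_bigr => i _.
  by rewrite [map_mx _ _ _ _]mxE -intrM.
by have [-> ->] := cos_sin_2pi_int (theta m x) (\sum_i m 0 i * z 0 i).
Qed.

Lemma ccts_mode m : ccts (mode m).
Proof. exact/cC1_ccts/csmooth_cC1/csmooth_mode. Qed.

(** A nonconstant mode is, up to a nonzero factor, its own partial derivative in
    some direction, and the integral of a derivative vanishes. *)
Lemma torus_cintegral_mode m : CT (mode m) = (`|\det B|)%:C%C *+ (m == 0).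
Proof.
have [->|m0] := eqVneq m 0.
  rewrite (_ : mode 0 = fun=> 1) ?torus_cintegral_cst ?mulr1//.
  by apply/funext => x; rewrite mode0.
have [j fj] : exists j, freq m j != 0.
  apply/existsP; rewrite -negb_forall; apply: contra m0 => /forallP f0.
  by apply/eqP/freq_eq0 => j; apply/eqP; exact: f0.
have : CT (cpderiv j (mode m)) = 0.
  apply: torus_cintegral_cpderiv => //; last exact: periodic_mode.
  exact/csmooth_cC1/csmooth_mode.
rewrite (_ : cpderiv j (mode m) = fun x => (0 +i* freq m j)%C * mode m x); last first.
  by apply/funext => x; rewrite cpderiv_mode.
rewrite torus_cintegralZ; last exact: ccts_mode.
move/eqP; rewrite mulf_eq0 => /orP[|/eqP ->//].
by rewrite eq_complex /= (negPf fj) andbF.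
Qed.

(** The factor [mode (- m)] is the complex conjugate of [mode m]; the coefficient
    is not divided by the volume. *)
Definition fourier m f : C := CT (fun x => f x * mode (- m) x).

Lemma vol_neq0 : (`|\det B|)%:C%C != 0 :> C.
Proof.
rewrite eq_complex /= eqxx andbT normr_eq0.
by move: hB; rewrite unitmxE unitfE.
Qed.

Lemma fourier_mode m m' : fourier m (mode m') = (`|\det B|)%:C%C *+ (m == m').
Proof.
rewrite /fourier (_ : (fun x => _) = mode (m' - m)); last first.
  by apply/funext => x; rewrite mode_add.
by rewrite torus_cintegral_mode subr_eq0 eq_sym.
Qed.

Lemma fourierZ m c f : ccts f -> fourier m (fun x => c * f x) = c * fourier m f.
Proof.
move=> cf; rewrite /fourier -torus_cintegralZ; last by apply: cctsM => //; exact: ccts_mode.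
by congr torus_cintegral; apply/funext => x; rewrite mulrA.
Qed.

Lemma fourier_sum (I : Type) (r : seq I) (P : pred I) m (F : I -> 'rV[R]_n -> C) :
  (forall i, P i -> ccts (F i)) ->
  fourier m (fun x => \sum_(i <- r | P i) F i x) = \sum_(i <- r | P i) fourier m (F i).
Proof.
move=> cF; rewrite /fourier -torus_cintegral_sum.
  by congr torus_cintegral; apply/funext => x; rewrite big_distrl.
by move=> i Pi; apply: cctsM; [exact: cF|exact: ccts_mode].
Qed.

Lemma fourierD m f g : ccts f -> ccts g ->
  fourier m (fun x => f x + g x) = fourier m f + fourier m g.
Proof.
move=> cf cg; rewrite /fourier -torus_cintegralD; [|by apply: cctsM => //; exact: ccts_mode..].
by congr torus_cintegral; apply/funext => x; rewrite mulrDl.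
Qed.

Lemma fourier_pderiv m j f : cC1 f -> periodic B f ->
  fourier m (cpderiv j f) = (0 +i* freq m j)%C * fourier m f.
Proof.
move=> cf pf; rewrite /fourier torus_cintegral_by_parts//; last 2 first.
- exact/csmooth_cC1/csmooth_mode.
- exact: periodic_mode.
rewrite (_ : (fun x => f x * _) = fun x => (0 -i* freq m j)%C * (f x * mode (- m) x)).
  rewrite torus_cintegralZ; last by apply: cctsM; [exact: cC1_ccts|exact: ccts_mode].
  by rewrite -[LHS]mulNr; congr (_ * _); apply: complex_eq => /=; rewrite ?oppr0 ?opprK.
by apply/funext => x; rewrite cpderiv_mode freqN mulrCA.
Qed.

Lemma lattice_floor x : exists2 v, lattice B v & exists2 u, cube u & x = u *m B + v.
Proof.
pose y := x *m invmx B; pose z : 'rV[int]_n := \row_i Num.floor (y 0 i).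
exists (map_mx intr z *m B); first by exists z.
exists (y - map_mx intr z).
  move=> i; have -> : (y - map_mx intr z) 0 i = y 0 i - (Num.floor (y 0 i))%:~R.
    by rewrite mxE [in X in _ + X]mxE [in X in _ - X]mxE [in X in _ - X]mxE.
  have /andP[h1 h2] := floor_itv (y 0 i); rewrite intrD in h2.
  by rewrite in_itv /=; apply/andP; split; [rewrite subr_ge0|rewrite lerBlDr addrC ltW].
by rewrite -mulmxDl subrK -mulmxA mulVmx// mulmx1.
Qed.

(** Completeness of the modes.  Combining the coefficients of m and -m shows that
    f is orthogonal to the cosine and to the sine of each phase; as these are
    real, so are the real and imaginary parts of f, and [cube_uniqueness]
    applies in the coordinates of the lattice basis. *)
Lemma fourier_inj f : ccts f -> periodic B f -> (forall m, fourier m f = 0) ->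
  forall x, f x = 0.
Proof.
move=> cf pf f0.
have [fr fi] := cf.
have cm m : ccts (fun x => f x * mode m x) by apply: cctsM => //; exact: ccts_mode.
have I0 m : CT (fun x => f x * mode m x) = 0 by have := f0 (- m); rewrite /fourier opprK.
have det0 : `|\det B| != 0 by have := vol_neq0; rewrite eq_complex /= eqxx andbT.
have I1 m (a b : C) : CT (fun x => f x * (a * mode m x + b * mode (- m) x)) = 0.
  rewrite (_ : (fun x => _) = (fun x => a * (f x * mode m x) + b * (f x * mode (- m) x))).
    have cz c h : ccts h -> ccts (fun x => c * h x).
      by move=> ch; apply: cctsM => //; exact: ccts_cst.
    by rewrite torus_cintegralD ?torus_cintegralZ ?I0 ?mulr0 ?addr0//; exact: cz.
  by apply/funext => x; rewrite mulrDr !(mulrCA (f x)).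
(* Euler's formulas for the cosine and the sine. *)
have cosE m x : (1 / 2)%:C%C * mode m x + (1 / 2)%:C%C * mode (- m) x = (cos (theta m x))%:C%C.
  by apply: complex_eq; rewrite ?ReD ?ImD ?ReM ?ImM /= theta_opp ?cosN ?sinN; field.
have sinE m x : (0 -i* (1 / 2))%C * mode m x + (0 +i* (1 / 2))%C * mode (- m) x = (sin (theta m x))%:C%C.
  by apply: complex_eq; rewrite ?ReD ?ImD ?ReM ?ImM /= theta_opp ?cosN ?sinN; field.
have I2 m : CT (fun x => f x * (cos (theta m x))%:C%C) = 0.
  by rewrite -[RHS](I1 m (1 / 2)%:C%C (1 / 2)%:C%C); congr torus_cintegral;
    apply/funext => x; rewrite cosE.
have I3 m : CT (fun x => f x * (sin (theta m x))%:C%C) = 0.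
  by rewrite -[RHS](I1 m (0 -i* (1 / 2))%C (0 +i* (1 / 2))%C); congr torus_cintegral;
    apply/funext => x; rewrite sinE.
have ReI h (k : 'rV[R]_n -> R) : (forall u, k u = Re (h (u *m B))) -> CT h = 0 -> cube_integral k = 0.
  move=> hk; move/(congr1 Re) => /= /eqP; rewrite mulf_eq0 (negPf det0) /= => /eqP k0.
  by rewrite -[RHS]k0; congr cube_integral; apply/funext => u /=.
have ImI h (k : 'rV[R]_n -> R) : (forall u, k u = Im (h (u *m B))) -> CT h = 0 -> cube_integral k = 0.
  move=> hk; move/(congr1 Im) => /= /eqP; rewrite mulf_eq0 (negPf det0) /= => /eqP k0.
  by rewrite -[RHS]k0; congr cube_integral; apply/funext => u /=.
have Re0 := @cube_uniqueness R n _ (@continuous_mulmx_comp _ _ B _ fr).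
have Im0 := @cube_uniqueness R n _ (@continuous_mulmx_comp _ _ B _ fi).
move=> x; have [v vl [u uc ->]] := lattice_floor x; rewrite pf//.
apply: complex_eq.
- apply: Re0 => // m; split; [apply: ReI (I2 m)|apply: ReI (I3 m)] => w;
    by rewrite ReM /= theta_phase mulr0 subr0.
- apply: Im0 => // m; split; [apply: ImI (I2 m)|apply: ImI (I3 m)] => w;
    by rewrite ImM /= theta_phase mulr0 add0r.
Qed.

End Modes.

(** * Dimensions of eigenspaces *)

Section HasDim.
Context {K : fieldType}.
Implicit Types V W : lmodType K.

(** Were the first basis longer than the second, the matrix expressing it in the
    second one would have dependent rows. *)
Lemma has_dim_le V (E : set V) k k' : has_dim E k -> has_dim E k' -> (k <= k')%N.
Proof.
move=> [e [Ee fe]] [e' [Ee' fe']].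
have he i : E (e i).
  apply/Ee; exists (delta_mx 0 i); rewrite (bigD1 i)//= mxE !eqxx scale1r big1 ?addr0//.
  by move=> j /negPf ji; rewrite mxE ji andbF scale0r.
have /choice[M hM] : forall i, exists c : 'rV[K]_k', e i = \sum_(j < k') c 0 j *: e' j.
  by move=> i; apply/Ee'/he.
pose A : 'M[K]_(k, k') := \matrix_i M i.
suff : row_free A by move=> /eqP <-; exact: rank_leq_col.
rewrite -kermx_eq0; apply/eqP/row_matrixP => i; rewrite row0; apply: fe.
under eq_bigr do rewrite hM scaler_sumr; rewrite exchange_big big1//= => j _.
under eq_bigr do rewrite scalerA; rewrite -scaler_suml.
suff -> : \sum_i0 (row i (kermx A)) 0 i0 * M i0 0 j = (row i (kermx A) *m A) 0 j.
  by rewrite -row_mul mulmx_ker row0 mxE scale0r.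
by rewrite mxE; apply: eq_bigr => i0 _; rewrite [A _ _]mxE.
Qed.

Lemma dimensionE V (E : set V) k : has_dim E k -> dimension E = Some k.
Proof.
move=> Ek; apply: xget_unique; first by exists k.
move=> _ [k' Ek' <-]; congr Some; apply/eqP; rewrite eqn_leq.
by rewrite !(has_dim_le _ Ek, has_dim_le _ Ek').
Qed.

Lemma has_dim_zero V : has_dim [set 0 : V] 0.
Proof.
exists (fun=> 0); split=> [v|c _]; last by apply/rowP => -[].
split=> [->|[c ->]]; last by rewrite big_ord0.
by exists 0; rewrite big_ord0.
Qed.

Lemma has_dim_image V W (E : set V) k (f : V -> W) : has_dim E k ->
  (forall (a : K) u v, f (a *: u + v) = a *: f u + f v) ->
  (forall v, E v -> f v = 0 -> v = 0) ->
  has_dim (f @` E) k.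
Proof.
move=> [e [Ee fe]] lf jf.
pose F := GRing.isLinear.Build K V W *:%R f lf.
pose g : {linear V -> W} := HB.pack f F.
have fs (c : 'rV[K]_k) : f (\sum_(i < k) c 0 i *: e i) = \sum_(i < k) c 0 i *: f (e i).
  by rewrite -[f]/(g : V -> W) linear_sum; apply: eq_bigr => i _; rewrite linearZ.
exists (f \o e); split=> [w|c].
- split=> [[v /Ee[c ->] <-]|[c ->]]; first by exists c; exact: fs.
  by exists (\sum_(i < k) c 0 i *: e i); [apply/Ee; exists c|exact: fs].
- rewrite -fs => /jf /fe; apply; apply/Ee; by exists c.
Qed.

Lemma has_dim_add V (E1 E2 : set V) k1 k2 : has_dim E1 k1 -> has_dim E2 k2 ->
  (forall u v, E1 u -> E2 v -> u + v = 0 -> u = 0) ->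
  has_dim [set u + v | u in E1 & v in E2] (k1 + k2).
Proof.
move=> [e1 [Ee1 fe1]] [e2 [Ee2 fe2]] H.
pose e (i : 'I_(k1 + k2)) := match fintype.split i with inl i => e1 i | inr i => e2 i end.
have eE (c : 'rV[K]_(k1 + k2)) : \sum_i c 0 i *: e i =
    \sum_i lsubmx c 0 i *: e1 i + \sum_i rsubmx c 0 i *: e2 i.
  rewrite big_split_ord /=; congr (_ + _); apply: eq_bigr => i _; rewrite mxE /e.
    by rewrite (unsplitK (inl i)).
  by rewrite (unsplitK (inr i)).
exists e; split=> [w|c].
- split=> [[u /Ee1[c1 ->] [v /Ee2[c2 ->] <-]]|[c ->]].
    by exists (row_mx c1 c2); rewrite eE row_mxKl row_mxKr.
  rewrite eE; exists (\sum_i lsubmx c 0 i *: e1 i).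
    by apply/Ee1; exists (lsubmx c).
  by exists (\sum_i rsubmx c 0 i *: e2 i) => //; apply/Ee2; exists (rsubmx c).
- rewrite eE => s0.
  have u0 : \sum_i lsubmx c 0 i *: e1 i = 0.
    apply: (H _ _ _ _ s0); first by apply/Ee1; exists (lsubmx c).
    by apply/Ee2; exists (rsubmx c).
  move: s0; rewrite u0 add0r => /fe2 r0.
  by rewrite -[c]hsubmxK (fe1 _ u0) r0 row_mx0.
Qed.

End HasDim.

Section IdempotentTrace.
Context {K : numFieldType} {T : finType}.
Local Notation V := (T -> K^o).

(** A full-rank factorisation A = col_base A * row_base A of an idempotent
    satisfies row_base A * col_base A = 1, and the trace is cyclic. *)
Lemma mxrank_idempotent N (A : 'M[K]_N) : A *m A = A -> (\rank A)%:R = \tr A.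
Proof.
move=> AA; have E : row_base A *m col_base A = 1%:M.
  have : col_base A *m (row_base A *m col_base A) *m row_base A = col_base A *m row_base A.
    by rewrite mulmxA -(mulmxA _ (col_base A)) mulmx_base AA.
  rewrite -[X in _ = X *m _]mulmx1; move/(row_free_inj (row_base_free A)).
  have /row_fullP[D DC] := col_base_full A.
  by move=> /(congr1 (fun X => D *m X)) /=; rewrite mulmx1 (mulmxA D) DC mul1mx.
have -> : \tr A = \tr (col_base A *m row_base A) by rewrite mulmx_base.
by rewrite mxtrace_mulC E mxtrace1.
Qed.

Definition basis_fun (s : T) : V := fun t => (t == s)%:R.

(** Computes the dimension of the eigenspaces without exhibiting bases, since
    the diagonal entries of the projections are easy to sum. *)
Lemma has_dim_idempotent (P : V -> V) k :
  (forall (a : K) u v, P (a *: u + v) = a *: P u + P v) ->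
  (forall v, P (P v) = P v) ->
  \sum_t P (basis_fun t) t = k%:R ->
  has_dim (range P) k.
Proof.
move=> lP PP trP.
pose F := GRing.isLinear.Build K V V *:%R P lP.
pose g : {linear V -> V} := HB.pack P F.
pose N := #|T|.
pose A : 'M[K]_N := \matrix_(i, j) P (basis_fun (enum_val i)) (enum_val j).
pose r (v : V) : 'rV[K]_N := \row_j v (enum_val j).
pose d (x : 'rV[K]_N) : V := fun t => x 0 (enum_rank t).
have sE (a : K) (f : V) t : (a *: f) t = a * f t by [].
have rK v : d (r v) = v by apply/funext => t; rewrite /d mxE enum_rankK.
have dK x : r (d x) = x by apply/rowP => j; rewrite mxE /d enum_valK.
have vE (v : V) : v = \sum_(i < N) v (enum_val i) *: basis_fun (enum_val i).
  apply/funext => t; rewrite fct_sumE /= (bigD1 (enum_rank t))//= enum_rankK big1 ?addr0.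
    by rewrite sE /basis_fun eqxx mulr1.
  move=> i ie; rewrite sE /basis_fun; case: (eqVneq t) => [E|_]; last by rewrite mulr0.
  by rewrite E enum_valK eqxx in ie.
have PZ a u : P (a *: u) = a *: P u by exact: (linearZ_LR g).
have rP v : r (P v) = r v *m A.
  apply/rowP => j; rewrite mxE {1}[v]vE -[P]/(g : V -> V) linear_sum fct_sumE mxE /=.
  by apply: eq_bigr => i _; rewrite PZ sE !mxE.
have AA : A *m A = A.
  apply/row_matrixP => i; rewrite row_mul.
  have -> : row i A = r (P (basis_fun (enum_val i))) by apply/rowP => j; rewrite !mxE.
  by rewrite -rP PP.
have rk : \rank A = k.
  apply/eqP; rewrite -(eqr_nat K) mxrank_idempotent// -trP; apply/eqP.
  rewrite /mxtrace (reindex (@enum_rank T)) /=; last first.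
    by exists (@enum_val T T) => ? _; rewrite ?enum_rankK ?enum_valK.
  by apply: eq_bigr => t _; rewrite mxE !enum_rankK.
have dsum (c : 'rV[K]_(\rank A)) : \sum_i c 0 i *: d (row i (row_base A)) = d (c *m row_base A).
  apply/funext => t; rewrite fct_sumE /d mxE /=; apply: eq_bigr => i _.
  by rewrite sE mxE.
rewrite -rk; exists (fun i => d (row i (row_base A))); split=> [v|c].
- split=> [[u _ <-]|[c ->]].
    have /submxP[c hc] : (r (P u) <= row_base A)%MS by rewrite eq_row_base rP submxMl.
    by exists c; rewrite dsum -hc rK.
  have /submxP[x hx] : (c *m row_base A <= A)%MS.
    by rewrite (submx_trans (submxMl _ _))// eq_row_base.
  by exists (d x) => //; rewrite dsum hx -(rK (P _)) rP dK.
- rewrite dsum => /(congr1 r); rewrite dK => c0.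
  have : c *m row_base A = 0 by rewrite c0; apply/rowP => j; rewrite !mxE.
  by move/eqP; rewrite mulmx_free_eq0 ?row_base_free// => /eqP.
Qed.

End IdempotentTrace.

(** * Creation and annihilation operators on covectors *)

Section ExteriorAlgebra.
Context {K : numFieldType} {n : nat}.
Local Notation V := ({set 'I_n} -> K^o).
Implicit Types (c : V) (I J L : {set 'I_n}) (i j k : 'I_n) (xi : 'I_n -> K).

(** The sign produced by moving dx_j to its place among the factors of dx_J. *)
Definition insertion_sign j J : K := (-1) ^+ #|[pred i in J | (i < j)%N]|.

Lemma insertion_sign_sq j J : insertion_sign j J * insertion_sign j J = 1.
Proof. by rewrite /insertion_sign -expr2 sqrr_sign. Qed.

Lemma insertion_signD1 j k J : k \in J -> insertion_sign j J = (-1) ^+ (k < j)%N * insertion_sign j (J :\ k).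
Proof.
move=> kJ; rewrite /insertion_sign -exprD; congr (_ ^+ _).
rewrite (cardD1 k) !inE kJ /=; congr (_ + _)%N.
by apply: eq_card => i; rewrite !inE andbA.
Qed.

(** The exterior product by dx_j and, below, its adjoint, the contraction by the
    j-th basis vector. *)
Definition creation j c : V := fun J => if j \in J then insertion_sign j J * c (J :\ j) else 0.
Definition annihilation j c : V :=
  fun I => if j \notin I then insertion_sign j (j |: I) * c (j |: I) else 0.

(** The canonical anticommutation relation.  For j <> k both products move c
    between the same index sets, and the signs differ because exactly one of
    j < k and k < j holds. *)
Lemma creation_annihilation j k c J :
  creation j (annihilation k c) J + annihilation k (creation j c) J = c J *+ (j == k).
Proof.
rewrite /creation /annihilation; have [->|jk] := eqVneq j k.
  rewrite !inE eqxx /=; case: ifP => kJ; rewrite /= ?addr0 ?add0r.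
    by rewrite finset.setD1K// mulrA insertion_sign_sq mul1r.
  by rewrite finset.setU1K ?kJ// mulrA insertion_sign_sq mul1r.
rewrite !inE eq_sym jk /= (negPf jk) /=.
case: (boolP (j \in J)) => jJ; case: (boolP (k \in J)) => kJ //=;
  rewrite ?mulr0 ?addr0//.
have E : (k |: J) :\ j = k |: (J :\ j).
  by apply/setP => i; rewrite !inE; case: (eqVneq i j) => //= ->; rewrite (negPf jk).
have E1 : J = (k |: J) :\ k by rewrite finset.setU1K.
have jL : j \in k |: J by rewrite !inE jJ orbT.
have kL : k \in k |: J by rewrite !inE eqxx.
rewrite (insertion_signD1 k jL) (insertion_signD1 j kL) -E1 E.
have : (-1) ^+ (j < k)%N * (-1) ^+ (k < j)%N = -1 :> K.
  by case: (ltngtP j k) => [_|_|/val_inj E']; rewrite ?expr0 ?expr1 ?mul1r ?mulr1//;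
    rewrite E' eqxx in jk.
set s1 := insertion_sign j J; set s2 := insertion_sign k _; set x := (-1) ^+ _; set y := (-1) ^+ _.
move=> xy; have -> : x * s2 * (y * s1 * c (k |: J :\ j)) = (x * y) * (s1 * (s2 * c (k |: J :\ j))).
  by ring.
by rewrite xy mulN1r subrr.
Qed.

Lemma annihilation_anticomm j k c I :
  annihilation j (annihilation k c) I = - annihilation k (annihilation j c) I.
Proof.
rewrite /annihilation; have [->|jk] := eqVneq j k.
  by rewrite !inE eqxx /=; case: ifP => _; rewrite ?mulr0 oppr0.
have kj : k != j by rewrite eq_sym.
rewrite !inE (negPf jk) (negPf kj) /=.
case: (boolP (j \in I)) => jI; case: (boolP (k \in I)) => kI /=;
  rewrite ?mulr0 ?oppr0//.
have E : j |: (k |: I) = k |: (j |: I) by rewrite finset.setUCA.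
rewrite E; set L := k |: (j |: I).
have E1 : j |: I = L :\ k by rewrite finset.setU1K// !inE negb_or eq_sym jk.
have E2 : k |: I = L :\ j by rewrite /L -E finset.setU1K// !inE negb_or jk.
have jL : j \in L by rewrite !inE eqxx orbT.
have kL : k \in L by rewrite !inE eqxx.
rewrite E1 E2 (insertion_signD1 k jL) (insertion_signD1 j kL).
have xy : (-1) ^+ (j < k)%N = - (-1) ^+ (k < j)%N :> K.
  by case: (ltngtP j k) => [_|_|/val_inj E']; rewrite ?expr0 ?expr1 ?opprK//;
    rewrite E' eqxx in jk.
by rewrite xy; ring.
Qed.

Definition wedge xi c : V := fun J => \sum_j xi j * creation j c J.
Definition contraction xi c : V := fun I => \sum_j xi j * annihilation j c I.

Lemma wedge_linear xi (a : K) u v : wedge xi (a *: u + v) = a *: wedge xi u + wedge xi v.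
Proof.
apply/funext => J; rewrite -[RHS]/(a * wedge xi u J + wedge xi v J) /wedge big_distrr -big_split.
apply: eq_bigr => j _ /=; rewrite /creation; case: ifP => _; last by ring.
by rewrite -[(a *: u + v) _]/(a * u (J :\ j) + v (J :\ j)); ring.
Qed.

Lemma contraction_linear xi (a : K) u v :
  contraction xi (a *: u + v) = a *: contraction xi u + contraction xi v.
Proof.
apply/funext => J.
rewrite -[RHS]/(a * contraction xi u J + contraction xi v J) /contraction big_distrr -big_split.
apply: eq_bigr => j _ /=; rewrite /annihilation; case: ifP => _; last by ring.
by rewrite -[(a *: u + v) _]/(a * u (j |: J) + v (j |: J)); ring.
Qed.

Definition sqnorm xi : K := \sum_j xi j ^+ 2.

Lemma creation_sum j xi (F : 'I_n -> V) J :
  creation j (fun L => \sum_k xi k * F k L) J = \sum_k xi k * creation j (F k) J.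
Proof.
rewrite /creation; case: ifP => jJ; last by rewrite big1// => k _; rewrite mulr0.
by rewrite big_distrr; apply: eq_bigr => k _; rewrite /= mulrCA.
Qed.

Lemma annihilation_sum j xi (F : 'I_n -> V) J :
  annihilation j (fun L => \sum_k xi k * F k L) J = \sum_k xi k * annihilation j (F k) J.
Proof.
rewrite /annihilation; case: ifP => jJ; last by rewrite big1// => k _; rewrite mulr0.
by rewrite big_distrr; apply: eq_bigr => k _; rewrite /= mulrCA.
Qed.

(** Cartan's identity: the symbol of the Laplacian is the squared length of the
    frequency, by bilinearity from [creation_annihilation]. *)
Lemma wedge_contraction xi c :
  wedge xi (contraction xi c) + contraction xi (wedge xi c) = sqnorm xi *: c.
Proof.
apply/funext => J.
rewrite -[LHS]/(wedge xi (contraction xi c) J + contraction xi (wedge xi c) J).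
rewrite -[RHS]/(sqnorm xi * c J).
have -> : wedge xi (contraction xi c) J =
    \sum_j \sum_k xi j * (xi k * creation j (annihilation k c) J).
  by apply: eq_bigr => j _; rewrite creation_sum big_distrr.
have -> : contraction xi (wedge xi c) J =
    \sum_j \sum_k xi j * (xi k * annihilation k (creation j c) J).
  rewrite exchange_big; apply: eq_bigr => j _; rewrite annihilation_sum big_distrr.
  by apply: eq_bigr => k _ /=; rewrite mulrCA.
rewrite -big_split big_distrl; apply: eq_bigr => j _.
rewrite -big_split /= (bigD1 j)//= big1 ?addr0 => [|k kj].
  by rewrite -!mulrDr creation_annihilation eqxx mulr1n expr2 mulrA.
by rewrite -!mulrDr creation_annihilation eq_sym (negPf kj) !mulr0.
Qed.

Lemma contraction_contraction xi c : contraction xi (contraction xi c) = 0.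
Proof.
apply/funext => J; rewrite -[RHS]/(0 : K).
set S := LHS; have SE : S = \sum_j \sum_k xi j * (xi k * annihilation j (annihilation k c) J).
  by apply: eq_bigr => j _; rewrite annihilation_sum big_distrr.
have : S = - S.
  rewrite {2}SE exchange_big SE -sumrN; apply: eq_bigr => j _; rewrite -sumrN.
  by apply: eq_bigr => k _; rewrite annihilation_anticomm /=; ring.
move/eqP; rewrite -subr_eq0 opprK -mulr2n mulrn_eq0 /= => /eqP //.
Qed.

Lemma wedge0 xi : wedge xi 0 = 0.
Proof.
apply/funext => J; rewrite /wedge big1// => j _.
by rewrite /creation; case: ifP => _; rewrite ?mulr0// -[0 _]/(0 : K) !mulr0.
Qed.

End ExteriorAlgebra.

(** * The action of F on a single mode *)

Section SymbolEigenspace.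
Context {K : numFieldType} {n : nat}.
Local Notation V := ({set 'I_n} -> K^o).
Implicit Types (c : V) (I J L : {set 'I_n}) (i j k : 'I_n) (xi : 'I_n -> K).

Definition degree_part p c : V := fun I => if #|I| == p then c I else 0.

Lemma degree_part_id p c : (forall I, #|I| != p -> c I = 0) -> degree_part p c = c.
Proof. by move=> h; apply/funext => I; rewrite /degree_part; case: ifPn => // /h ->. Qed.

Lemma wedge_contraction_degree xi p c :
  wedge xi (contraction xi (degree_part p c)) = degree_part p (wedge xi (contraction xi c)).
Proof.
apply/funext => J; rewrite /wedge.
have H j : creation j (contraction xi (degree_part p c)) J =
    if #|J| == p then creation j (contraction xi c) J else 0.
  rewrite !creation_sum; case: ifPn => Jp.
    apply: eq_bigr => k _; congr (_ * _); rewrite /creation /annihilation.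
    case: ifP => // jJ; case: ifP => // kJ; rewrite /degree_part.
    have -> : #|k |: J :\ j| = #|J| by rewrite cardsU1 kJ [in RHS](cardsD1 j) jJ.
    by rewrite Jp.
  rewrite big1// => k _; rewrite /creation /annihilation.
  case: ifP => // [jJ|]; last by rewrite mulr0.
  case: ifP => // kJ; rewrite ?mulr0// /degree_part.
  have -> : #|k |: J :\ j| = #|J| by rewrite cardsU1 kJ [in RHS](cardsD1 j) jJ.
  by rewrite (negPf Jp) !mulr0.
rewrite /degree_part; case: ifPn => Jp.
  by apply: eq_bigr => j _; rewrite H Jp.
by rewrite big1// => j _; rewrite H (negPf Jp) mulr0.
Qed.

(** Only the terms that remove j from I and put the same j back return to I, and
    their signs square to 1. *)
Lemma wedge_contraction_diag xi I :
  wedge xi (contraction xi (basis_fun I)) I = \sum_(j in I) xi j ^+ 2.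
Proof.
rewrite [RHS]big_mkcond; apply: eq_bigr => j _; rewrite creation_sum.
rewrite (bigD1 j)//= big1 ?addr0 => [|k kj].
  rewrite /creation /annihilation; case: ifP => jI; rewrite ?mulr0//.
  rewrite !inE eqxx /= finset.setD1K// /basis_fun eqxx !mulr1 insertion_sign_sq.
  by rewrite mulr1 expr2.
rewrite /creation /annihilation; case: ifP => // jI; rewrite ?mulr0//.
rewrite !inE (negPf kj) /=; case: ifP => kI; rewrite ?mulr0//.
rewrite /basis_fun; case: eqP => [E|_]; last by rewrite !mulr0.
by move: kI; rewrite -E !inE eqxx.
Qed.

Lemma pascal_pred m p : (0 < m)%N -> (0 < p)%N ->
  'C(m, p) = ('C(m.-1, p) + 'C(m.-1, p.-1))%N.
Proof. by case: m p => [|m] [|p] // _ _; rewrite binS. Qed.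

Lemma card_sets_size p : #|[set I : {set 'I_n} | #|I| == p]%SET| = 'C(n, p).
Proof.
rewrite -[n in RHS]card_ord -card_draws; apply: eq_card => I.
by rewrite !inE.
Qed.

Lemma card_sets_notin p j : #|[set I : {set 'I_n} | (#|I| == p) && (j \notin I)]%SET| = 'C(n.-1, p).
Proof.
have <- : #|~: [set j]%SET| = n.-1 by rewrite cardsC1 card_ord.
rewrite -cards_draws; apply: eq_card => I; rewrite !inE andbC; congr (_ && _).
apply/idP/fintype.subsetP => [jI i iI|h]; first by rewrite !inE; apply: contraNneq jI => <-.
by apply/negP => /h; rewrite !inE eqxx.
Qed.

Lemma card_sets_in p j : (0 < p)%N ->
  #|[set I : {set 'I_n} | (#|I| == p) && (j \in I)]%SET| = 'C(n.-1, p.-1).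
Proof.
move=> p0; have n0 : (0 < n)%N by case: n j => // -[].
pose S := [set I : {set 'I_n} | #|I| == p]%SET; pose D := [set I : {set 'I_n} | j \in I]%SET.
have := cardsID D S; rewrite card_sets_size (pascal_pred n0 p0).
have -> : S :&: D = [set I : {set 'I_n} | (#|I| == p) && (j \in I)]%SET.
  by apply/setP => I; rewrite !inE.
have -> : S :\: D = [set I : {set 'I_n} | (#|I| == p) && (j \notin I)]%SET.
  by apply/setP => I; rewrite !inE andbC.
by rewrite card_sets_notin addnC => /addnI.
Qed.

(** Each j belongs to 'C(n-1, p-1) of the sets of size p. *)
Lemma symbol_trace xi p : (0 < p)%N ->
  \sum_(I : {set 'I_n} | #|I| == p) \sum_(j in I) xi j ^+ 2 = sqnorm xi * ('C(n.-1, p.-1))%:R.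
Proof.
move=> p0; rewrite (exchange_big_dep xpredT)//= big_distrl; apply: eq_bigr => j _ /=.
rewrite sumr_const -[LHS]mulr_natr; congr (_ * _%:R).
rewrite -(card_sets_in j p0); apply: eq_card => I; rewrite !inE//.
Qed.

(** The eigenvectors of the symbol of F at frequency xi among p-covectors. *)
Definition mode_eigenspace xi p (a b l : K) : set V :=
  [set c | (forall I, #|I| != p -> c I = 0) /\
    a *: wedge xi (contraction xi c) + b *: contraction xi (wedge xi c) = l *: c].

(** Let W = wedge o contraction and W' = contraction o wedge.  Since W + W' is the
    scalar s and the contraction squares to zero, W W' = W' W = 0, W W = s W and
    W' W' = s W'.  So the eigenspace is the range of the projection obtained from
    W / s and W' / s by keeping those whose eigenvalue a s or b s equals l; the
    dimension is its trace. *)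
Lemma has_dim_mode_eigenspace xi p a b l : (0 < p)%N -> sqnorm xi != 0 ->
  has_dim (mode_eigenspace xi p a b l)
    ((l == a * sqnorm xi)%R * 'C(n.-1, p.-1) + (l == b * sqnorm xi)%R * 'C(n.-1, p)).
Proof.
move=> p0 s0; set s := sqnorm xi.
pose W c := wedge xi (contraction xi c); pose W' c := contraction xi (wedge xi c).
have lW (x : K) u v : W (x *: u + v) = x *: W u + W v.
  by rewrite /W contraction_linear wedge_linear.
have lW' (x : K) u v : W' (x *: u + v) = x *: W' u + W' v.
  by rewrite /W' wedge_linear contraction_linear.
have WW' c : W c + W' c = s *: c by exact: wedge_contraction.
have W'E c : W' c = s *: c - W c by rewrite -WW' addrC addKr.
have W0 : W 0 = 0.
  by apply: (addrI (W 0)); rewrite addr0 -{1}[W 0]scale1r -lW scale1r addr0.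
have W'0 : W' 0 = 0.
  by apply: (addrI (W' 0)); rewrite addr0 -{1}[W' 0]scale1r -lW' scale1r addr0.
have WZ (x : K) u : W (x *: u) = x *: W u.
  by have := lW x u 0; rewrite W0 !addr0.
have W'Z (x : K) u : W' (x *: u) = x *: W' u.
  by have := lW' x u 0; rewrite W'0 !addr0.
have WD u v : W (u + v) = W u + W v by have := lW 1 u v; rewrite !scale1r.
have W'D u v : W' (u + v) = W' u + W' v by have := lW' 1 u v; rewrite !scale1r.
have WoW' c : W (W' c) = 0.
  by rewrite /W /W' contraction_contraction wedge0.
have W'oW c : W' (W c) = 0.
  have := WoW' c; rewrite [W' c]W'E WD -scaleN1r !WZ scaleN1r.
  by rewrite [W' (W c)]W'E.
have WW c : W (W c) = s *: W c.
  by have := WW' (W c); rewrite W'oW addr0.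
have W'W' c : W' (W' c) = s *: W' c.
  by have := WW' (W' c); rewrite WoW' add0r.
have pW c : W (degree_part p c) = degree_part p (W c) by exact: wedge_contraction_degree.
have pZ (x : K) c : degree_part p (x *: c) = x *: degree_part p c.
  apply/funext => I; rewrite -[RHS]/(x * degree_part p c I) /degree_part.
  by case: ifP; rewrite ?mulr0.
have pD u v : degree_part p (u + v) = degree_part p u + degree_part p v.
  apply/funext => I; rewrite -[RHS]/(degree_part p u I + degree_part p v I) /degree_part.
  by case: ifP; rewrite ?addr0.
have pp c : degree_part p (degree_part p c) = degree_part p c.
  by apply: degree_part_id => I; rewrite /degree_part => /negPf ->.
have pW' c : W' (degree_part p c) = degree_part p (W' c).
  by rewrite !W'E pW pD pZ -scaleN1r -[in RHS]scaleN1r pZ.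
set ea := (l == a * s); set eb := (l == b * s).
pose x : K := ea%:R / s; pose y : K := eb%:R / s.
have ee (e : bool) : e%:R / s * (e%:R / s * s) = e%:R / s :> K.
  by rewrite mulfVK//; case: e; rewrite ?mul0r ?mulr0 ?mulr1.
have alg (u v t X : K) : u * X + v * (t - X) = v * t + (u - v) * X by ring.
pose Q c : V := x *: W c + y *: W' c.
pose P c : V := degree_part p (Q c).
have QQ c : Q (Q c) = Q c.
  rewrite /Q WD W'D !WZ !W'Z WoW' W'oW WW W'W' !scaler0 addr0 add0r !scalerA.
  by rewrite -[x * x * s]mulrA -[y * y * s]mulrA [x * (x * s)](ee ea) [y * (y * s)](ee eb).
have pQ c : Q (degree_part p c) = degree_part p (Q c).
  by rewrite /Q pW pW' pD !pZ.
rewrite (_ : mode_eigenspace _ _ _ _ _ = range P).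
  apply: has_dim_idempotent.
  - move=> z u v; rewrite /P -pZ -pD; congr degree_part.
    rewrite /Q lW lW' !scalerDr !scalerA addrACA [x * z]mulrC [y * z]mulrC.
    by [].
  - by move=> c; rewrite /P pQ QQ pp.
  - have -> : \sum_I P (basis_fun I) I =
       \sum_(I : {set 'I_n} | #|I| == p) (y * s + (x - y) * \sum_(j in I) xi j ^+ 2).
      rewrite [RHS]big_mkcond; apply: eq_bigr => I _; rewrite /P /degree_part.
      case: ifP => // _; rewrite /Q W'E.
      rewrite -[LHS]/(x * W (basis_fun I) I + y * (s * basis_fun I I - W (basis_fun I) I)).
      by rewrite /W wedge_contraction_diag /basis_fun eqxx mulr1; exact: alg.
    rewrite big_split /= sumr_const -big_distrr /= symbol_trace//.
    have -> : #|[pred I : {set 'I_n} | #|I| == p]| = 'C(n, p).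
      by rewrite -card_sets_size; apply: eq_card => I; rewrite !inE.
    have -> : 'C(n, p) = ('C(n.-1, p) + 'C(n.-1, p.-1))%N.
      have n0 : (0 < n)%N.
        rewrite lt0n; apply: contraNneq s0 => n0; rewrite /sqnorm big1// => j.
        by have := ltn_ord j; rewrite [X in (_ < X)%N]n0.
      exact: pascal_pred.
    rewrite -mulr_natr !natrD !natrM -/s /x /y.
    by field.
apply/seteqP; split=> [c [cp ce]|_ [c _ <-]].
  exists c => //; rewrite /P.
  have ceW : (l - a * s) *: W c = 0.
    have := congr1 W ce; rewrite -/(W c) -/(W' c) WD !WZ WoW' WW scaler0 addr0 scalerA.
    by move=> E; rewrite scalerBl E subrr.
  have ceW' : (l - b * s) *: W' c = 0.
    have := congr1 W' ce; rewrite -/(W c) -/(W' c) W'D !W'Z W'oW W'W' scaler0 add0r scalerA.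
    by move=> E; rewrite scalerBl E subrr.
  have xW : x *: W c = s^-1 *: W c.
    rewrite /x /ea; case: eqVneq => [_|le]; first by rewrite mul1r.
    by move/eqP: ceW; rewrite scaler_eq0 subr_eq0 (negPf le) => /eqP ->; rewrite !scaler0.
  have yW : y *: W' c = s^-1 *: W' c.
    rewrite /y /eb; case: eqVneq => [_|le]; first by rewrite mul1r.
    by move/eqP: ceW'; rewrite scaler_eq0 subr_eq0 (negPf le) => /eqP ->; rewrite !scaler0.
  by rewrite /Q xW yW -scalerDr WW' scalerA mulVf// scale1r degree_part_id.
split=> [I|]; first by rewrite /P /degree_part => /negPf ->.
rewrite -/(W _) -/(W' _) /P pW pW' -!pZ -pD; congr degree_part.
rewrite /Q WD W'D !WZ !W'Z WoW' W'oW WW W'W' !scaler0 addr0 add0r scalerDr !scalerA.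
have ex : a * (x * s) = l * x.
  by rewrite /x /ea; case: eqVneq => [->|_] /=; [field|rewrite !mul0r !mulr0].
have ey : b * (y * s) = l * y.
  by rewrite /y /eb; case: eqVneq => [->|_] /=; [field|rewrite !mul0r !mulr0].
by rewrite -ex -ey !mulrA.
Qed.

Lemma has_dim_mode_eigenspace0 xi p a b l : xi =1 (fun=> 0) ->
  has_dim (mode_eigenspace xi p a b l) ((l == 0)%R * 'C(n, p)).
Proof.
move=> xi0.
have w0 c : wedge xi c = 0.
  by apply/funext => J; rewrite /wedge big1// => j _; rewrite xi0 mul0r.
have c0 c : contraction xi c = 0.
  by apply/funext => J; rewrite /contraction big1// => j _; rewrite xi0 mul0r.
pose P c : V := if l == 0 then degree_part p c else 0.
rewrite (_ : mode_eigenspace _ _ _ _ _ = range P).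
  apply: has_dim_idempotent.
  - move=> z u v; rewrite /P; case: ifP => _; last by rewrite scaler0 addr0.
    apply/funext => I; rewrite -[RHS]/(z * degree_part p u I + degree_part p v I) /degree_part.
    by case: ifP => _; rewrite ?mulr0 ?addr0.
  - move=> v; rewrite /P; case: (l == 0) => //.
    by apply/funext => I; rewrite /degree_part; case: (#|I| == p).
  - rewrite /P; case: (l == 0); last by rewrite big1.
    rewrite mul1n -card_sets_size -sum1_card natr_sum [RHS]big_mkcond.
    by apply: eq_bigr => I _; rewrite /degree_part inE /basis_fun eqxx.
apply/seteqP; split=> [c [cp]|_ [c _ <-]].
  rewrite w0 c0 !scaler0 addr0 => /esym/eqP; rewrite scaler_eq0 => /orP[l0|/eqP ->].
    by exists c => //; rewrite /P l0 degree_part_id.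
  by exists 0 => //; rewrite /P degree_part_id//; case: ifP.
split=> [I Ip|].
  by rewrite /P /degree_part; case: ifP => // _; rewrite (negPf Ip).
rewrite w0 c0 !scaler0 addr0 /P; case: ifP => [/eqP ->|_]; last by rewrite scaler0.
by rewrite scale0r.
Qed.

End SymbolEigenspace.

(** * Differential forms on the torus and the codifferential *)

Section TorusForms.
Context {R : realType} {n : nat} (B : 'M[R]_n) (hB : B \in unitmx).
Local Notation C := R[i].
Local Notation csign := (@insertion_sign R[i] n).
Local Notation CT := (torus_cintegral B).
Local Notation fourier := (fourier B).
Local Notation mode := (mode B).
Implicit Types (w t h : dform R n) (I J : {set 'I_n}) (j : 'I_n) (m : 'rV[int]_n).

Lemma periodic_cpderiv j (f : 'rV[R]_n -> C) : periodic B f -> periodic B (cpderiv j f).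
Proof.
move=> pf x v vl.
have P (g : C -> R) : pderiv j (g \o f) (x + v) = pderiv j (g \o f) x.
  rewrite /pderiv /derive.
  under eq_fun => h do rewrite /= addrA !(pf _ v)//.
  by [].
by rewrite /cpderiv !P.
Qed.

Lemma Omega_all_csmooth w I : Omega_all B w -> csmooth (fun x => w x I).
Proof. by move=> [sw _]; exact: sw. Qed.

Lemma Omega_all_periodic w I : Omega_all B w -> periodic B (fun x => w x I).
Proof. by move=> [_ pw] x v vl; rewrite pw. Qed.

(** The candidate for the adjoint of d, found by integrating by parts in each
    summand of the exterior derivative. *)
Definition codiff_formula w : dform R n := fun x I =>
  - \sum_(j | j \notin I) csign j (j |: I) *
      cpderiv j (fun y => w y (j |: I)) x.

Lemma Omega_ext_deriv w : Omega_all B w -> Omega_all B (ext_deriv w).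
Proof.
move=> ow; split=> [J|x v vl].
  apply: csmooth_sum => j _; apply: csmoothZ; apply: csmooth_pderiv.
  exact: Omega_all_csmooth.
apply/funext => J; apply: eq_bigr => j _; congr (_ * _).
by rewrite periodic_cpderiv//; exact: Omega_all_periodic.
Qed.

Lemma Omega_codiff_formula w : Omega_all B w -> Omega_all B (codiff_formula w).
Proof.
move=> ow; split=> [J|x v vl].
  have := @csmoothZ R n (-1) (fun x => \sum_(j | j \notin J) csign j (j |: J) *
      cpderiv j (fun y => w y (j |: J)) x).
  have -> : (fun x => -1 * \sum_(j | j \notin J) csign j (j |: J) *
      cpderiv j (fun y => w y (j |: J)) x) = (fun x => codiff_formula w x J).
    by apply/funext => x; rewrite mulN1r.
  apply; apply: csmooth_sum => j _; apply: csmoothZ; apply: csmooth_pderiv.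
  exact: Omega_all_csmooth.
apply/funext => J; congr (- _); apply: eq_bigr => j _; congr (_ * _).
by rewrite periodic_cpderiv//; exact: Omega_all_periodic.
Qed.

Lemma csign_conj j J : (csign j J)^* = csign j J.
Proof. by rewrite /insertion_sign rmorphXn rmorphN1. Qed.

(** Removing an element of a set and adding an element to a set are inverse
    operations on pairs; this is what makes the sums in d and in its adjoint
    match. *)
Lemma sum_insert (V : nmodType) (G : 'I_n -> {set 'I_n} -> V) :
  \sum_(J : {set 'I_n}) \sum_(j in J) G j J =
  \sum_(I : {set 'I_n}) \sum_(j | j \notin I) G j (j |: I).
Proof.
rewrite (exchange_big_dep xpredT)//= [RHS](exchange_big_dep xpredT)//=.
apply: eq_bigr => j _.
rewrite (reindex_onto (fun I => j |: I) (fun J => J :\ j)) /=.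
  apply: eq_bigl => I; rewrite finset.setU11 /=.
  have [jI|jI] := boolP (j \in I); last by rewrite finset.setU1K ?eqxx.
  by apply/negbTE; apply: contraTneq jI => <-; rewrite !inE eqxx.
by move=> J jJ; rewrite finset.setD1K.
Qed.

Lemma codiff_formula_adjoint t w : Omega_all B t -> Omega_all B w ->
  L2_inner B (ext_deriv t) w = L2_inner B t (codiff_formula w).
Proof.
move=> ot ow.
have ct I : cC1 (fun x => t x I) by apply/csmooth_cC1/Omega_all_csmooth.
have cw I : cC1 (fun x => w x I) by apply/csmooth_cC1/Omega_all_csmooth.
have cw' I : cC1 (fun x => (w x I)^*) by exact: cC1_conj.
have pt I : periodic B (fun x => t x I) by exact: Omega_all_periodic.
have pw I : periodic B (fun x => (w x I)^*).
  by move=> x v vl; rewrite (Omega_all_periodic I ow).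
pose G j J := csign j J * CT (fun x => cpderiv j (fun y => t y (J :\ j)) x * (w x J)^*).
have cG j J : ccts (fun x => cpderiv j (fun y => t y (J :\ j)) x * (w x J)^*).
  by apply: cctsM; [exact: cC1_pderiv|exact: cC1_ccts].
have cH j J : ccts (fun x => t x (J :\ j) * cpderiv j (fun y => (w y J)^*) x).
  by apply: cctsM; [exact: cC1_ccts|exact: cC1_pderiv].
have cs c (f : 'rV[R]_n -> C) : ccts f -> ccts (fun x => c * f x).
  by move=> cf; apply: cctsM => //; exact: ccts_cst.
have -> : L2_inner B (ext_deriv t) w = \sum_(J : {set 'I_n}) \sum_(j in J) G j J.
  rewrite /L2_inner.
  rewrite (_ : (fun x => _) = (fun x => \sum_(J : {set 'I_n}) \sum_(j in J) csign j J *
    (cpderiv j (fun y => t y (J :\ j)) x * (w x J)^*))); last first.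
    apply/funext => x; apply: eq_bigr => J _; rewrite big_distrl.
    by apply: eq_bigr => j _; rewrite mulrA.
  rewrite torus_cintegral_sum => [|J _]; last by apply: ccts_sum => j _; exact: cs.
  apply: eq_bigr => J _; rewrite torus_cintegral_sum => [|j _]; last exact: cs.
  by apply: eq_bigr => j _; rewrite torus_cintegralZ.
rewrite sum_insert /L2_inner.
rewrite (_ : (fun x => _) = (fun x => \sum_(I : {set 'I_n}) \sum_(j | j \notin I)
   - csign j (j |: I) *
    (t x I * cpderiv j (fun y => (w y (j |: I))^*) x))); last first.
  apply/funext => x; apply: eq_bigr => I _; rewrite rmorphN rmorph_sum mulrN big_distrr -sumrN.
  apply: eq_bigr => j _; rewrite rmorphM /= csign_conj cpderiv_conj//.
  by rewrite mulNr mulrCA.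
have cH' j I : j \notin I -> ccts (fun x => t x I * cpderiv j (fun y => (w y (j |: I))^*) x).
  by move=> jI; have := cH j (j |: I); rewrite finset.setU1K.
rewrite torus_cintegral_sum => [|J _]; last by apply: ccts_sum => j jJ; apply: cs; exact: cH'.
apply: eq_bigr => I _; rewrite torus_cintegral_sum => [|j jI]; last by apply: cs; exact: cH'.
apply: eq_bigr => j jI; rewrite torus_cintegralZ; last exact: cH'.
by rewrite /G torus_cintegral_by_parts// finset.setU1K// mulrN mulNr.
Qed.

Definition mode_form m (c : {set 'I_n} -> C) : dform R n := fun x I => mode m x * c I.

Lemma Omega_mode_form m c : Omega_all B (mode_form m c).
Proof.
split=> [I|x v vl].
  have := csmoothZ (c I) (csmooth_mode B m).
  by congr csmooth; apply/funext => x; rewrite mulrC.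
by apply/funext => I; rewrite /mode_form periodic_mode.
Qed.

Definition form_coef m w I : C := fourier m (fun x => w x I).

Lemma form_coef_inj w w' : Omega_all B w -> Omega_all B w' ->
  (forall m, form_coef m w =1 form_coef m w') -> w = w'.
Proof.
move=> ow ow' ww'; apply/funext => x; apply/funext => I; apply/eqP; rewrite -subr_eq0.
apply/eqP; have c1 : ccts (fun x => w x I) by apply/cC1_ccts/csmooth_cC1/Omega_all_csmooth.
have c2 : ccts (fun x => w' x I) by apply/cC1_ccts/csmooth_cC1/Omega_all_csmooth.
have c3 : ccts (fun x => -1 * w' x I) by apply: cctsM => //; exact: ccts_cst.
rewrite -mulN1r.
apply: (@fourier_inj _ _ _ hB (fun x => w x I + -1 * w' x I) (cctsD c1 c3)) => [y v vl|m].
  by rewrite (Omega_all_periodic I ow)// (Omega_all_periodic I ow').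
rewrite fourierD// fourierZ//; have := ww' m I; rewrite /form_coef => ->.
by rewrite mulN1r subrr.
Qed.

Lemma L2_inner_mode_form m I w : Omega_all B w ->
  L2_inner B (mode_form m (fun J => (J == I)%:R)) w = (form_coef m w I)^*.
Proof.
move=> ow; rewrite /L2_inner.
have -> : (fun x => \sum_J mode_form m (fun J => (J == I)%:R) x J * (w x J)^*) =
   (fun x => mode m x * (w x I)^*).
  apply/funext => x; rewrite (bigD1 I)//= big1 ?addr0 /mode_form ?eqxx ?mulr1//.
  by move=> J /negPf ->; rewrite mulr0 mul0r.
rewrite /form_coef /fourier; apply: complex_eq; rewrite ?Re_conj ?Im_conj /=.
  congr torus_integral; apply/funext => x /=.
  by rewrite -[mode _ _]conjCK mode_conj -rmorphM mulrC Re_conj.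
have c1 : ccts (fun x => w x I) by apply/cC1_ccts/csmooth_cC1/Omega_all_csmooth.
have [_ ci] := cctsM c1 (ccts_mode B (- m)).
rewrite -[RHS]mulN1r -torus_integralZ//.
congr torus_integral; apply/funext => x /=.
by rewrite -[mode _ _ in LHS]conjCK mode_conj -rmorphM mulrC Im_conj mulN1r.
Qed.

(** Testing the adjunction against the forms e_m dx_I shows that it determines
    all Fourier coefficients of the adjoint, hence the adjoint itself. *)
Lemma codiffE w : Omega_all B w -> codiff B w = codiff_formula w.
Proof.
move=> ow; apply: xget_unique.
  by split; [exact: Omega_codiff_formula|move=> t ot; exact: codiff_formula_adjoint].
move=> h [oh hadj]; apply: form_coef_inj => // [|m I]; first exact: Omega_codiff_formula.
have om := Omega_mode_form m (fun J => (J == I)%:R).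
apply: (can_inj (@conjCK C)).
rewrite -!L2_inner_mode_form//; last exact: Omega_codiff_formula.
by rewrite -hadj// codiff_formula_adjoint.
Qed.

Lemma form_coef_ext_deriv_sum m w J : Omega_all B w -> form_coef m (ext_deriv w) J =
  \sum_(j in J) csign j J * ((0 +i* freq B m j)%C * form_coef m w (J :\ j)).
Proof.
move=> ow; have cw I : cC1 (fun x => w x I) by apply/csmooth_cC1/Omega_all_csmooth.
rewrite /form_coef fourier_sum => [|j jJ].
  apply: eq_bigr => j jJ; rewrite fourierZ; last exact: cC1_pderiv.
  by rewrite fourier_pderiv//; exact: Omega_all_periodic.
by apply: cctsM; [exact: ccts_cst|exact: cC1_pderiv].
Qed.

Lemma form_coef_codiff_sum m w I : Omega_all B w -> form_coef m (codiff_formula w) I =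
  - \sum_(j | j \notin I) csign j (j |: I) *
      ((0 +i* freq B m j)%C * form_coef m w (j |: I)).
Proof.
move=> ow; have cw J : cC1 (fun x => w x J) by apply/csmooth_cC1/Omega_all_csmooth.
have cc j J : ccts (fun x => csign j (j |: I) * cpderiv j (fun y => w y J) x).
  by apply: cctsM; [exact: ccts_cst|exact: cC1_pderiv].
rewrite /form_coef (_ : (fun x => _) = fun x => -1 * \sum_(j | j \notin I) csign j (j |: I) *
      cpderiv j (fun y => w y (j |: I)) x); last by apply/funext => x; rewrite mulN1r.
rewrite fourierZ ?mulN1r; last by apply: ccts_sum.
rewrite fourier_sum//; congr (- _); apply: eq_bigr => j jI.
rewrite fourierZ; last exact: cC1_pderiv.
by rewrite fourier_pderiv//; exact: Omega_all_periodic.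
Qed.

End TorusForms.

(** * Eigenforms as finite combinations of modes *)

Section Spectrum.
Context {R : realType} {n : nat} (B : 'M[R]_n) (hB : B \in unitmx).
Local Notation C := R[i].
Local Notation V := ({set 'I_n} -> C^o).
Local Notation modef := (mode_form B).
Local Notation fhat := (form_coef B).
Implicit Types (w : dform R n) (I J : {set 'I_n}) (j : 'I_n) (m : 'rV[int]_n) (c : V).

Definition cfreq m : 'I_n -> C := fun j => (freq B m j)%:C%C.

Definition sqfreq m : R := \sum_j freq B m j ^+ 2.

Lemma sqnorm_cfreq m : sqnorm (cfreq m) = (sqfreq m)%:C%C.
Proof. by rewrite /sqnorm /sqfreq rmorph_sum; apply: eq_bigr => j _; rewrite rmorphXn. Qed.

Lemma form_coef_ext_deriv m w : Omega_all B w ->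
  fhat m (ext_deriv w) = 'i%C *: wedge (cfreq m) (fhat m w).
Proof.
move=> ow; apply/funext => J; rewrite form_coef_ext_deriv_sum//.
rewrite -[RHS]/('i%C * wedge (cfreq m) (fhat m w) J) /wedge big_distrr big_mkcond.
apply: eq_bigr => j _ /=; rewrite /creation; case: ifP => _; last by rewrite !mulr0.
have -> : (0 +i* freq B m j)%C = 'i%C * cfreq m j.
  by apply: complex_eq; rewrite ?ReM ?ImM /=; ring.
by ring.
Qed.

Lemma form_coef_codiff m w : Omega_all B w ->
  fhat m (codiff_formula w) = - 'i%C *: contraction (cfreq m) (fhat m w).
Proof.
move=> ow; apply/funext => J; rewrite form_coef_codiff_sum//.
rewrite -[RHS]/(- 'i%C * contraction (cfreq m) (fhat m w) J) /contraction mulNr.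
rewrite big_distrr big_mkcond; congr (- _).
apply: eq_bigr => j _ /=; rewrite /annihilation; case: ifP => _; last by rewrite !mulr0.
have -> : (0 +i* freq B m j)%C = 'i%C * cfreq m j.
  by apply: complex_eq; rewrite ?ReM ?ImM /=; ring.
by ring.
Qed.

Lemma Omega_all_linear (x : C) w w' : Omega_all B w -> Omega_all B w' ->
  Omega_all B (x *: w + w').
Proof.
move=> ow ow'; split=> [I|y v vl].
  have := csmoothD (csmoothZ x (Omega_all_csmooth I ow)) (Omega_all_csmooth I ow').
  by [].
have [_ pw] := ow; have [_ pw'] := ow'.
rewrite -[LHS]/(x *: w (y + v) + w' (y + v)) -[RHS]/(x *: w y + w' y).
by rewrite pw// pw'.
Qed.

Lemma Omega_all0 : Omega_all B 0.
Proof. by split=> // I; exact: csmooth_cst. Qed.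

Lemma Omega_allZ (x : C) w : Omega_all B w -> Omega_all B (x *: w).
Proof. by move=> ow; rewrite -[_ *: _]addr0; apply: Omega_all_linear => //; exact: Omega_all0. Qed.

Lemma Omega_allD w w' : Omega_all B w -> Omega_all B w' -> Omega_all B (w + w').
Proof. by move=> ow ow'; rewrite -[w]scale1r; exact: Omega_all_linear. Qed.

Lemma form_coef_lin m (x : C) w w' : Omega_all B w -> Omega_all B w' ->
  fhat m (x *: w + w') = x *: fhat m w + fhat m w'.
Proof.
move=> ow ow'; apply/funext => I.
rewrite -[RHS]/(x * fhat m w I + fhat m w' I) /form_coef.
have c1 : ccts (fun x => w x I) by apply/cC1_ccts/csmooth_cC1/(Omega_all_csmooth _ ow).
have c2 : ccts (fun x => w' x I) by apply/cC1_ccts/csmooth_cC1/(Omega_all_csmooth _ ow').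
have c3 : ccts (fun y => x * w y I) by apply: cctsM => //; exact: ccts_cst.
by rewrite -fourierZ// -fourierD.
Qed.

Lemma form_coef0 m : fhat m 0 = 0.
Proof.
by apply: (addrI (fhat m 0)); rewrite addr0 -{1}[fhat m 0]scale1r -form_coef_lin ?scale1r ?addr0//; exact: Omega_all0.
Qed.

Lemma form_coefZ m (x : C) w : Omega_all B w -> fhat m (x *: w) = x *: fhat m w.
Proof.
by move=> ow; have := form_coef_lin m x ow Omega_all0; rewrite !addr0 form_coef0 addr0.
Qed.

Lemma form_coefD m w w' : Omega_all B w -> Omega_all B w' ->
  fhat m (w + w') = fhat m w + fhat m w'.
Proof. by move=> ow ow'; have := form_coef_lin m 1 ow ow'; rewrite !scale1r. Qed.

Lemma form_coef_mode_form m m' c :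
  fhat m (modef m' c) = ((`|\det B|)%:C%C *+ (m == m')) *: c.
Proof.
apply/funext => I; rewrite -[RHS]/(_ * c I) -fourier_mode// mulrC.
rewrite /form_coef -fourierZ; last exact: ccts_mode.
by congr fourier; apply/funext => x; rewrite mulrC.
Qed.

Lemma wedgeZ xi (x : C) c : wedge xi (x *: c) = x *: wedge xi c.
Proof. by have := wedge_linear xi x c 0; rewrite wedge0 !addr0. Qed.

Lemma contraction0 xi : contraction xi 0 = 0 :> V.
Proof.
apply: (addrI (contraction xi 0)).
by rewrite addr0 -{1}[contraction xi 0]scale1r -contraction_linear scale1r addr0.
Qed.

Lemma contractionZ xi (x : C) c : contraction xi (x *: c) = x *: contraction xi c.
Proof. by have := contraction_linear xi x c 0; rewrite contraction0 !addr0. Qed.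

Lemma Omega_F_op a b w : Omega_all B w -> Omega_all B (F_op B a b w).
Proof.
move=> ow; have od := Omega_ext_deriv ow; have oc := Omega_codiff_formula ow.
rewrite /F_op (codiffE hB ow) (codiffE hB od).
by apply: Omega_all_linear; [exact: Omega_ext_deriv|apply: Omega_allZ; exact: Omega_codiff_formula].
Qed.

(** F acts on the coefficients of each mode through its symbol; the factors i
    and -i of d and delta multiply to 1. *)
Lemma form_coef_F_op m a b w : Omega_all B w -> fhat m (F_op B a b w) =
  a%:C%C *: wedge (cfreq m) (contraction (cfreq m) (fhat m w)) +
  b%:C%C *: contraction (cfreq m) (wedge (cfreq m) (fhat m w)).
Proof.
move=> ow; have od := Omega_ext_deriv ow; have oc := Omega_codiff_formula ow.
have odc := Omega_ext_deriv oc; have ocd := Omega_codiff_formula od.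
rewrite /F_op (codiffE hB ow) (codiffE hB od).
have ocd' : Omega_all B (b%:C%C *: codiff_formula (ext_deriv w)) by exact: Omega_allZ.
rewrite (form_coef_lin m _ odc ocd').
rewrite (form_coefZ m _ ocd).
rewrite (form_coef_ext_deriv m oc).
rewrite (form_coef_codiff m ow).
rewrite (form_coef_codiff m od).
rewrite (form_coef_ext_deriv m ow).
rewrite wedgeZ contractionZ.
rewrite !scalerA.
have ii : 'i%C * 'i%C = -1 :> C by rewrite -expr2 sqr_i.
have -> : a%:C%C * 'i%C * - 'i%C = a%:C%C by rewrite mulrN -mulrA ii mulrN1 opprK.
by have -> : b%:C%C * - 'i%C * 'i%C = b%:C%C by rewrite mulrN mulNr -mulrA ii mulrN1 opprK.
Qed.

Local Notation E a b p l := [set w | Omega B p w /\ F_op B a b w = l *: w].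
Local Notation Em a b p l m := (mode_eigenspace (cfreq m) p a%:C%C b%:C%C l).

Lemma form_coef_degree p m w I : Omega B p w -> #|I| != p -> fhat m w I = 0.
Proof.
move=> [ow wp] Ip; rewrite /form_coef.
rewrite (_ : (fun x => w x I) = fun x => 0 * mode B 0 x).
  by rewrite fourierZ ?mul0r//; exact: ccts_mode.
by apply/funext => x; rewrite mul0r wp.
Qed.

(** The eigenvalue equation decouples into one finite-dimensional equation for
    each mode. *)
Lemma eigenformP a b p l w : Omega B p w ->
  (F_op B a b w = l *: w <-> forall m, Em a b p l m (fhat m w)).
Proof.
move=> owp; have [ow wp] := owp; split=> [Fw m|H].
  split=> [I Ip|]; first exact: form_coef_degree owp Ip.
  by rewrite -form_coef_F_op// Fw form_coefZ.
apply: (form_coef_inj hB).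
- exact: Omega_F_op.
- exact: Omega_allZ.
- by move=> m I; rewrite form_coef_F_op// form_coefZ//; have [_ ->] := H m.
Qed.

Definition mode_mult (a b : R) p (l : C) m : nat :=
  (if (m == 0)%R then (l == 0)%R * 'C(n, p)
   else (l == (a * sqfreq m)%:C%C)%R * 'C(n.-1, p.-1) +
        (l == (b * sqfreq m)%:C%C)%R * 'C(n.-1, p))%N.

Lemma sqfreq_0 : sqfreq 0 = 0.
Proof. by rewrite /sqfreq big1// => j _; rewrite freq0 expr0n. Qed.

Lemma sqfreq_ge0 m : 0 <= sqfreq m.
Proof. by apply: sumr_ge0 => j _; exact: sqr_ge0. Qed.

Lemma sqfreq_eq0 m : (sqfreq m == 0) = (m == 0).
Proof.
apply/eqP/eqP => [|->]; last exact: sqfreq_0.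
move=> /psumr_eq0P H; apply: (freq_eq0 hB) => j.
by apply/eqP; rewrite -sqrf_eq0; apply/eqP/H => // i _; exact: sqr_ge0.
Qed.

Lemma has_dim_mode a b p l m : (0 < p)%N -> has_dim (Em a b p l m) (mode_mult a b p l m).
Proof.
move=> p0; rewrite /mode_mult; case: eqVneq => [->|m0].
  by apply: has_dim_mode_eigenspace0 => j; rewrite /cfreq freq0.
rewrite !rmorphM /= -sqnorm_cfreq; apply: has_dim_mode_eigenspace => //.
by rewrite sqnorm_cfreq eq_complex /= eqxx andbT sqfreq_eq0.
Qed.

Lemma Em_scale a b p l m (x : C) c : Em a b p l m c -> Em a b p l m (x *: c).
Proof.
move=> [cp ce]; split=> [I Ip|].
  by rewrite -[LHS]/(x * c I) cp ?mulr0.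
rewrite contractionZ wedgeZ wedgeZ contractionZ !scalerA.
by rewrite ![_ * x]mulrC -!scalerA -scalerDr ce.
Qed.

Definition finite_modes a b p l (S : seq 'rV[int]_n) : set (dform R n) :=
  [set w | exists2 c : 'rV[int]_n -> V, (forall m, m \in S -> Em a b p l m (c m)) &
     w = \sum_(m <- S) modef m (c m)].

Lemma Omega_all_sum (S : seq 'rV[int]_n) (c : 'rV[int]_n -> V) :
  Omega_all B (\sum_(m <- S) modef m (c m)).
Proof.
elim: S => [|m S IH]; first by rewrite big_nil; exact: Omega_all0.
by rewrite big_cons; apply: Omega_allD => //; exact: Omega_mode_form.
Qed.

Lemma form_coef_sum (S : seq 'rV[int]_n) (c : 'rV[int]_n -> V) m : uniq S ->
  fhat m (\sum_(m <- S) modef m (c m)) = ((`|\det B|)%:C%C *+ (m \in S)) *: c m.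
Proof.
elim: S => [_|m' S IH /= /andP[m'S uS]]; first by rewrite big_nil form_coef0 scale0r.
rewrite big_cons form_coefD; [|exact: Omega_mode_form|exact: Omega_all_sum].
rewrite IH// form_coef_mode_form inE; have [->|_] := eqVneq m m'; last by rewrite scale0r add0r.
by rewrite (negPf m'S) scale0r addr0.
Qed.

(** The sum over modes is direct because Fourier coefficients separate them. *)
Lemma has_dim_finite_modes a b p l S : (0 < p)%N -> uniq S ->
  has_dim (finite_modes a b p l S) (\sum_(m <- S) mode_mult a b p l m).
Proof.
move=> p0; elim: S => [_|m S IH /= /andP[mS uS]].
  rewrite big_nil (_ : finite_modes _ _ _ _ _ = [set 0]); first exact: has_dim_zero.
  apply/seteqP; split=> [w [c _ ->]|w ->]; first by rewrite big_nil.
  by exists (fun=> 0) => //; rewrite big_nil.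
have mlin (x : C) (u v : V) : modef m (x *: u + v) = x *: modef m u + modef m v.
  apply/funext => y; apply/funext => I.
  rewrite -[RHS]/(x * (mode B m y * u I) + mode B m y * v I).
  by rewrite /mode_form -[(x *: u + v) I]/(x * u I + v I); ring.
have minj (v : V) : Em a b p l m v -> modef m v = 0 -> v = 0.
  move=> _ /(congr1 (fhat m)); rewrite form_coef_mode_form form_coef0 eqxx => /eqP.
  by rewrite scaler_eq0 (negPf (vol_neq0 hB)) => /eqP.
rewrite big_cons.
rewrite (_ : finite_modes _ _ _ _ _ =
  [set u + v | u in modef m @` Em a b p l m & v in finite_modes a b p l S]).
  apply: has_dim_add; [|exact: IH|].
    exact: has_dim_image (has_dim_mode a b l m p0) mlin minj.
  move=> u v [c _ <-] [d _ ->] /(congr1 (fhat m)).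
  rewrite form_coefD; [|exact: Omega_mode_form|exact: Omega_all_sum].
  rewrite form_coef_sum// (negPf mS) scale0r addr0 form_coef_mode_form form_coef0 eqxx => /eqP.
  rewrite scaler_eq0 (negPf (vol_neq0 hB)) /= => /eqP ->.
  by apply/funext => y; apply/funext => I; rewrite /mode_form mulr0.
apply/seteqP; split=> [w [c hc ->]|_ [_ [c hc <-] [_ [d hd ->] <-]]].
  rewrite big_cons; exists (modef m (c m)); first by exists (c m) => //; apply: hc; rewrite mem_head.
  exists (\sum_(j <- S) modef j (c j)) => //; exists c => // m' m'S; apply: hc.
  by rewrite inE m'S orbT.
exists (fun m' => if m' == m then c else d m').
  by move=> m'; rewrite inE; case: eqVneq => [->|_] //= m'S; exact: hd.
rewrite big_cons eqxx; congr (_ + _); apply: eq_big_seq => m' m'S.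
by case: eqVneq => // mm; rewrite -mm m'S in mS.
Qed.

Lemma has_dim0_eq0 (W : lmodType C) (X : set W) v : has_dim X 0 -> X v -> v = 0.
Proof. by move=> [e [Ee _]] /Ee[c ->]; rewrite big_ord0. Qed.

(** An eigenform has no coefficient outside S, so it equals the sum of its modes
    in S by completeness; dividing by the volume normalises the coefficients. *)
Lemma eigenspaceE a b p l S : (0 < p)%N -> uniq S ->
  (forall m, mode_mult a b p l m != 0%N -> m \in S) ->
  E a b p l = finite_modes a b p l S.
Proof.
move=> p0 uS hS; have vol0 := vol_neq0 hB.
apply/seteqP; split=> [w [owp /(eigenformP _ _ _ owp) H]|w [c hc ->]].
  have [ow _] := owp.
  exists (fun m => ((`|\det B|)%:C%C)^-1 *: fhat m w).
    by move=> m _; apply: Em_scale; exact: H.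
  apply: (form_coef_inj hB) => // [|m I]; first exact: Omega_all_sum.
  rewrite form_coef_sum// scalerA; have [mS|mS] := boolP (m \in S).
    by rewrite mulr1n mulfV// scale1r.
  rewrite mulr0n mul0r scale0r; have := has_dim_mode a b l m p0.
  have -> : mode_mult a b p l m = 0%N by apply/eqP; apply: contraNT mS => /hS.
  by move=> /has_dim0_eq0 /(_ (H m)) ->.
have owp : Omega B p (\sum_(m <- S) modef m (c m)).
  split; first exact: Omega_all_sum.
  move=> x I Ip; rewrite !fct_sumE big1_seq// => m /andP[_ mS].
  by rewrite /mode_form; have [-> //] := hc _ mS; rewrite mulr0.
split=> //; apply/(eigenformP _ _ _ owp) => m; rewrite form_coef_sum//.
have [mS|mS] := boolP (m \in S); first by apply: Em_scale; exact: hc.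
rewrite mulr0n scale0r; split=> //.
by rewrite contraction0 !wedge0 contraction0 !scaler0 addr0.
Qed.

Lemma spectrumE a b p l S : (0 < p)%N -> uniq S ->
  (forall m, mode_mult a b p l m != 0%N -> m \in S) ->
  spectrum B p (F_op B a b) l = Some (\sum_(m <- S) mode_mult a b p l m).
Proof.
move=> p0 uS hS; rewrite /spectrum (eigenspaceE p0 uS hS).
by apply: dimensionE; exact: has_dim_finite_modes.
Qed.

End Spectrum.

(** * Counting lattice frequencies *)

Section Counting.
Context {R : realType} {n : nat} (B : 'M[R]_n) (hB : B \in unitmx).
Local Notation C := R[i].
Local Notation sqf := (sqfreq B).
Implicit Types (m : 'rV[int]_n).

Lemma norm_freq_le m j r : sqf m <= r -> `|freq B m j| <= r + 1.
Proof.
move=> mr; have : `|freq B m j| ^+ 2 <= r.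
  rewrite real_normK ?num_real//; apply: le_trans mr; rewrite /sqfreq (bigD1 j)//=.
  by rewrite lerDl; apply: sumr_ge0 => i _; exact: sqr_ge0.
have := sqr_ge0 (`|freq B m j| - 1).
rewrite sqrrB1 => h1 h2; have : 0 <= `|freq B m j| by [].
move: h1 h2; move: `|_| => x; rewrite expr2 mulr2n; nra.
Qed.

Lemma freq_mulB m i : 2 * pi * (m 0 i)%:~R = \sum_j freq B m j * B i j :> R.
Proof.
have -> : (m 0 i)%:~R = (map_mx intr m *m (invmx B)^T *m B^T) 0 i :> R.
  by rewrite -mulmxA -trmx_mul mulmxV// trmx1 mulmx1 mxE.
rewrite mxE big_distrr; apply: eq_bigr => j _ /=.
by rewrite freqE [B^T _ _]mxE mulrA.
Qed.

(** The integer vector m is a linear function of its frequency vector, so a bound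
    on the latter confines m to a box. *)
Lemma finite_frequencies r : exists S : seq 'rV[int]_n, uniq S /\
  forall m, sqf m <= r -> m \in S.
Proof.
pose M := (`|r| + 1) * \sum_i \sum_j `|B i j|.
have [N hN] : exists N : nat, M <= N%:R.
  by exists (Num.bound M); apply/ltW/archi_boundP; rewrite mulr_ge0 ?addr_ge0// sumr_ge0// => i _; rewrite sumr_ge0.
(* Functions into 0 .. 2N, shifted by N, enumerate the box of side 2N. *)
pose g (f : {ffun 'I_n -> 'I_(N + N).+1}) : 'rV[int]_n := \row_i ((f i)%:Z - N%:Z).
exists (undup [seq g f | f : {ffun 'I_n -> 'I_(N + N).+1}]); split; first exact: undup_uniq.
move=> m mr.
have mN i : `|m 0 i|%R <= N%:Z.
  rewrite -(ler_int R) intr_norm; apply: le_trans hN.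
  have pi2 := @pi_ge2 R.
  apply: (@le_trans _ _ (`|2 * pi * (m 0 i)%:~R|)).
    by rewrite normrM ler_peMl// ger0_norm; lra.
  rewrite freq_mulB (le_trans (ler_norm_sum _ _ _))//.
  apply: (@le_trans _ _ (\sum_j (`|r| + 1) * `|B i j|)).
    apply: ler_sum => j _; rewrite normrM ler_wpM2r//.
    by apply: norm_freq_le; apply: le_trans mr _; exact: ler_norm.
  rewrite -mulr_sumr ler_wpM2l ?addr_ge0// [leRHS](bigD1 i)//= lerDl.
  by apply: sumr_ge0 => k _; apply: sumr_ge0.
rewrite mem_undup; apply/codomP.
exists [ffun i : 'I_n => inord (absz (m 0 i + N%:Z))].
apply/rowP => i; rewrite mxE ffunE inordK.
  by have := mN i; rewrite ler_norml => /andP[]; move: (m 0 i) => z; lia.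
by have := mN i; rewrite ler_norml => /andP[]; move: (m 0 i) => z; lia.
Qed.

Lemma min_seq (T : eqType) (f : T -> R) (S : seq T) x0 : x0 \in S ->
  exists2 x, x \in S & forall y, y \in S -> f x <= f y.
Proof.
elim: S x0 => [//|a S IH] x0 _.
case: S IH => [_|b S IH].
  by exists a; rewrite ?mem_head// => y; rewrite inE => /eqP ->.
have [x xS hx] := IH b (mem_head _ _).
have [ax|/ltW xa] := leP (f a) (f x).
  exists a; first exact: mem_head.
  by move=> y; rewrite inE => /orP[/eqP ->//|/hx]; exact: le_trans.
exists x; first by rewrite inE xS orbT.
by move=> y; rewrite inE => /orP[/eqP ->//|/hx].
Qed.

Definition modes_upto r : seq 'rV[int]_n := sval (cid (finite_frequencies r)).

Lemma modes_upto_uniq r : uniq (modes_upto r).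
Proof. by rewrite /modes_upto; case: cid => S []. Qed.

Lemma mem_modes_upto r m : sqf m <= r -> m \in modes_upto r.
Proof. by rewrite /modes_upto; case: cid => S [_ h] /=; exact: h. Qed.

Definition shell_count s : nat := count (fun m => sqf m == s) (modes_upto s).

Lemma shell_countE s S : uniq S -> (forall m, sqf m = s -> m \in S) ->
  (\sum_(m <- S) (sqf m == s)%R)%N = shell_count s.
Proof.
move=> uS hS; rewrite -big_mkcond sum1_count /shell_count -!size_filter.
apply/perm_size/uniq_perm; rewrite ?filter_uniq ?modes_upto_uniq//.
move=> m; rewrite !mem_filter; case: eqP => //= ms.
by rewrite hS// mem_modes_upto// ms.
Qed.

Lemma shell_count_gt0 s : (0 < shell_count s)%N <-> exists m, sqf m = s.
Proof.
rewrite /shell_count -has_count; split=> [/hasP[m _ /eqP ms]|[m ms]]; first by exists m.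
by apply/hasP; exists m; [apply: mem_modes_upto; rewrite ms|rewrite ms].
Qed.

(** The mode m = 0 has eigenvalue 0 only, so it does not contribute here. *)
Lemma spectrum_pos p a b l : (0 < p)%N -> 0 < a -> 0 < b -> 0 < l ->
  spectrum B p (F_op B a b) l%:C%C =
  Some (shell_count (l / a) * 'C(n.-1, p.-1) + shell_count (l / b) * 'C(n.-1, p))%N.
Proof.
move=> p0 a0 b0 l0.
have la : 0 < l / a by rewrite divr_gt0.
have lb : 0 < l / b by rewrite divr_gt0.
pose S := modes_upto (l / a + l / b).
have uS : uniq S by exact: modes_upto_uniq.
have hS m : sqf m = l / a \/ sqf m = l / b -> m \in S.
  by move=> h; apply: mem_modes_upto; case: h => ->; rewrite ?lerDl ?lerDr ltW.
have E c m : 0 < c -> (l%:C%C == (c * sqf m)%:C%C :> C) = (sqf m == l / c).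
  move=> c0; rewrite (inj_eq (@complexI R)).
  by apply/eqP/eqP => ->; [rewrite mulrAC mulfV ?mul1r|rewrite mulrC divfK]; rewrite // gt_eqF.
have multE m : mode_mult B a b p l%:C%C m =
   ((sqf m == l / a)%R * 'C(n.-1, p.-1) + (sqf m == l / b)%R * 'C(n.-1, p))%N.
  rewrite /mode_mult !E//; case: eqVneq => [->|_ //].
  by rewrite sqfreq_0 eq_complex /= (gt_eqF l0) (lt_eqF la) (lt_eqF lb).
rewrite (spectrumE hB p0 uS); last first.
  move=> m; rewrite multE; case: (sqf m =P l / a) => [h _|_]; first by apply: hS; left.
  by case: (sqf m =P l / b) => [h _|_ //]; apply: hS; right.
congr Some; under eq_bigr do rewrite multE.
rewrite big_split -!big_distrl /= (@shell_countE (l / a))// ?(@shell_countE (l / b))//.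
  by move=> m mb; apply: hS; right.
by move=> m ma; apply: hS; left.
Qed.

Lemma exists_first_shell : (0 < n)%N -> exists2 s, 0 < s & (0 < shell_count s)%N /\
  forall t, 0 < t -> t < s -> shell_count t = 0%N.
Proof.
move=> n0; pose m0 : 'rV[int]_n := const_mx 1.
have m0N : m0 != 0.
  by apply/eqP => /rowP/(_ (Ordinal n0)); rewrite !mxE.
pose S := [seq m <- modes_upto (sqf m0) | m != 0].
have m0S : m0 \in S by rewrite mem_filter m0N mem_modes_upto.
have [m mS hm] := min_seq sqf m0S.
have mN : m != 0 by move: mS; rewrite mem_filter => /andP[].
exists (sqf m); first by rewrite lt_def sqfreq_ge0 andbT sqfreq_eq0.
split; first by apply/shell_count_gt0; exists m.
move=> t t0 tm; apply/eqP; rewrite -leqn0 leqNgt; apply/negP => /shell_count_gt0[m' m't].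
have : m' \in S.
  rewrite mem_filter -(sqfreq_eq0 hB) m't gt_eqF//=; apply: mem_modes_upto.
  by rewrite m't (le_trans (ltW tm))// hm.
by move/hm; rewrite m't leNgt tm.
Qed.

(** The modes of nonzero multiplicity form a finite set, as their squared
    frequency is 0, l / a or l / b. *)
Lemma spectrum_ext p a b a' b' : (0 < p)%N -> 0 < a -> 0 < b ->
  (forall l m, mode_mult B a b p l m = mode_mult B a' b' p l m) ->
  spectrum B p (F_op B a b) = spectrum B p (F_op B a' b').
Proof.
move=> p0 a0 b0 ab; apply/funext => l.
pose r := `|complex.Re l|; pose S := modes_upto (r / a + r / b).
have uS : uniq S by exact: modes_upto_uniq.
have rp c : 0 < c -> 0 <= r / c by move=> c0; apply: divr_ge0; [exact: normr_ge0|exact: ltW].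
have hS m : mode_mult B a b p l m != 0%N -> m \in S.
  have Q c : 0 < c -> l = (c * sqf m)%:C%C -> sqf m = r / c.
    move=> c0 le; rewrite /r le /= ger0_norm ?mulr_ge0 ?sqfreq_ge0 1?ltW//.
    by rewrite mulrAC mulfV ?mul1r// gt_eqF.
  move=> mm; apply: mem_modes_upto; move: mm; rewrite /mode_mult.
  case: (m =P 0) => [-> _|_]; first by rewrite sqfreq_0 addr_ge0// rp.
  case: (l =P (a * sqf m)%:C%C) => [/(Q a a0) -> _|_]; first by rewrite lerDl rp.
  by case: (l =P (b * sqf m)%:C%C) => [/(Q b b0) -> _|_ //]; rewrite lerDr rp.
rewrite (spectrumE hB p0 uS hS) (spectrumE hB p0 uS); last by move=> m; rewrite -ab; exact: hS.
by congr Some; apply: eq_bigr => m _; rewrite ab.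
Qed.

End Counting.

(** * Recovering the constants from the multiplicities *)

Section Comparison.
Context {R : realType} (N : R -> nat) (s : R) (s0 : 0 < s) (Ns : (0 < N s)%N).
Hypothesis Nlt : forall t, 0 < t -> t < s -> N t = 0%N.

(** The smallest positive l with N (l / c) nonzero is s * c. *)
Lemma scaled_count_inj c c' : 0 < c -> 0 < c' ->
  (forall l, 0 < l -> N (l / c) = N (l / c')) -> c = c'.
Proof.
have H x y : 0 < x -> 0 < y -> (forall l, 0 < l -> N (l / x) = N (l / y)) -> y <= x.
  move=> x0 y0 h; rewrite leNgt; apply/negP => xy.
  have l0 : 0 < s * x by rewrite mulr_gt0.
  have : N (s * x / y) = 0%N.
    by apply: Nlt; [rewrite divr_gt0|rewrite ltr_pdivrMr// ltr_pM2l].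
  by rewrite -(h _ l0) mulfK ?gt_eqF// => N0; move: Ns; rewrite N0.
move=> c0 c'0 h; apply/eqP; rewrite eq_le !H// => l l0.
by rewrite h.
Qed.

(** The smallest positive l where the count is nonzero is s times the minimum of
    the two scales.  If the minimum is attained on the same side in both pairs,
    the common summand cancels and [scaled_count_inj] identifies the other
    scale.  Otherwise evaluation at this smallest l gives A = D, after which the
    common summand cancels again. *)
Lemma scaled_counts_eq (A D : nat) (a b a' b' : R) : (0 < A)%N -> (0 < D)%N ->
  (0 < a)%R -> (0 < b)%R -> (0 < a')%R -> (0 < b')%R ->
  (forall l : R, 0 < l ->
     (N (l / a)%R * A + N (l / b)%R * D = N (l / a')%R * A + N (l / b')%R * D)%N) ->
  (a = a' /\ b = b') \/ [/\ A = D, a = b' & b = a'].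
Proof.
move=> A0 D0 a0 b0 a'0 b'0 H.
have Ngt c c' : 0 < c -> 0 < c' -> c < c' -> N (s * c / c') = 0%N.
  move=> c0 c'0 cc'; apply: Nlt; first by rewrite divr_gt0// mulr_gt0.
  by rewrite ltr_pdivrMr// ltr_pM2l.
have Nid c : 0 < c -> N (s * c / c) = N s by move=> c0; rewrite mulfK// gt_eqF.
have minle x y x' y' : 0 < x -> 0 < y -> 0 < x' -> 0 < y' ->
    (forall l : R, 0 < l ->
       (N (l / x)%R * A + N (l / y)%R * D = N (l / x')%R * A + N (l / y')%R * D)%N) ->
    Num.min x' y' <= Num.min x y.
  move=> x0 y0 x'0 y'0 h; rewrite leNgt; apply/negP; rewrite lt_min => /andP[h1 h2].
  have m0 : 0 < Num.min x y by rewrite lt_min x0.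
  have := h _ (mulr_gt0 s0 m0); rewrite (Ngt _ x')// (Ngt _ y')//.
  move: m0 {h1 h2}; case: (leP x y) => xy _; rewrite Nid// => /eqP; rewrite addn_eq0 !muln_eq0.
    by rewrite (gtn_eqF Ns) (gtn_eqF A0).
  by rewrite andbC (gtn_eqF Ns) (gtn_eqF D0).
have mm : Num.min a b = Num.min a' b'.
  apply/eqP; rewrite eq_le !minle// => l l0; by rewrite H.
have cancel (k x y : nat) : (0 < k)%N -> (x * k = y * k)%N -> x = y.
  by move=> k0 /eqP; rewrite eqn_pmul2r// => /eqP.
have same_first : a = a' -> (a = a' /\ b = b') \/ [/\ A = D, a = b' & b = a'].
  move=> e; left; split=> //; apply: scaled_count_inj => // l l0; apply: (cancel D) => //.
  by have := H l l0; rewrite e => /addnI.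
have same_second : b = b' -> (a = a' /\ b = b') \/ [/\ A = D, a = b' & b = a'].
  move=> e; left; split=> //; apply: scaled_count_inj => // l l0; apply: (cancel A) => //.
  by have := H l l0; rewrite e => /addIn.
have := mm; case: (leP a b) => ab; case: (leP a' b') => ab' // e.
- right; have aa' : a < a' by rewrite e.
  have := H _ (mulr_gt0 s0 a0); rewrite Nid// (Ngt _ a')// -e Nid// mul0n add0n => Ha.
  have ba : a < b.
    rewrite lt_def ab andbT; apply/eqP => ba; move: Ha.
    rewrite ba Nid// => /eqP; rewrite -[X in _ == X]add0n eqn_add2r muln_eq0.
    by rewrite (gtn_eqF Ns) (gtn_eqF A0).
  have AD : A = D.
    by apply: (cancel (N s)) => //; rewrite mulnC [RHS]mulnC -Ha (Ngt _ b)// addn0.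
  split=> //; apply: scaled_count_inj => // l l0; apply: (cancel A) => //.
  have := H l l0; rewrite -e -AD addnC => /addIn.
  by [].
- right; have bb' : b < a by [].
  have := H _ (mulr_gt0 s0 b0); rewrite Nid// (Ngt _ a)// e Nid// mul0n add0n => Hb.
  have b'b : b < b'.
    rewrite e lt_def ab' andbT; apply/eqP => b'a'; move: Hb.
    rewrite b'a' Nid// => /esym/eqP; rewrite -[X in _ == X]add0n eqn_add2r muln_eq0.
    by rewrite (gtn_eqF Ns) (gtn_eqF A0).
  have AD : A = D.
    by apply: (cancel (N s)) => //; rewrite mulnC [RHS]mulnC Hb (Ngt _ b') ?addn0// -e.
  split=> //; apply: scaled_count_inj => // l l0; apply: (cancel A) => //.
  have := H l l0; rewrite -e -AD [RHS]addnC => /addIn.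
  by [].
Qed.

End Comparison.

Lemma set2_eq (T : Type) (a b a' b' : T) : [set a; b] = [set a'; b'] <->
  (a = a' /\ b = b') \/ (a = b' /\ b = a').
Proof.
split=> [E|[[-> ->]|[-> ->]]]; last 2 first; [by []|exact: setUC|].
have [ea|ea] : [set a'; b'] a by rewrite -E; left.
  have [eb|eb] : [set a'; b'] b by rewrite -E; right.
    have [e|e] : [set a; b] b' by rewrite E; right.
      by left; split; rewrite // eb e.
    by left; split.
  by left.
have [eb|eb] : [set a'; b'] b by rewrite -E; right.
  by right.
have [e|e] : [set a; b] a' by rewrite E; left.
  by right; split; rewrite // eb e.
by right; split.
Qed.

(** The two binomials are related by p * 'C(n-1, p) = (n - p) * 'C(n-1, p-1). *)
Lemma bin_pred_eqE n p : (1 <= p)%N -> (p <= n)%N -> (p < n)%N ->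
  ('C(n.-1, p.-1) == 'C(n.-1, p)) = (n == 2 * p)%N.
Proof.
move=> p1 pn pn'.
have := mul_bin_left n.-1 p.-1; rewrite prednK// => E.
have D0 : (0 < 'C(n.-1, p))%N by rewrite bin_gt0; lia.
have np : (n.-1 - p.-1 = n - p)%N by lia.
rewrite np in E.
apply/eqP/eqP => [AD|n2].
  move: E; rewrite AD => /eqP; rewrite eqn_pmul2r// => /eqP; lia.
have e : (n - p = p)%N by lia.
move: E; rewrite e => /eqP; rewrite eqn_pmul2l// => /eqP //.
Qed.

Theorem theorem3p20 (R : realType) (n p : nat) (B : 'M[R]_n)
    (a a' b b' : R) (hB : B \in unitmx)
    (ha : 0 < a) (ha' : 0 < a') (hb : 0 < b) (hb' : 0 < b')
    (hp : (1 <= p <= n)%N) :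
  [/\ n <> (2 * p)%N -> p <> n ->
        (isospectral B p (F_op B a b) (F_op B a' b') <-> (a, b) = (a', b')),
      n = (2 * p)%N ->
        (isospectral B p (F_op B a b) (F_op B a' b') <->
         [set a; b] = [set a'; b'])
    & p = n ->
        (isospectral B p (F_op B a b) (F_op B a' b') <-> a = a')].
Proof.
have /andP[p0 pn] := hp; have n0 : (0 < n)%N by exact: leq_trans pn.
have [s s0 [Ns Nlt]] := exists_first_shell hB n0.
have A0 : (0 < 'C(n.-1, p.-1))%N by rewrite bin_gt0; lia.
have counts : isospectral B p (F_op B a b) (F_op B a' b') -> forall l, 0 < l ->
    (shell_count hB (l / a)%R * 'C(n.-1, p.-1) + shell_count hB (l / b)%R * 'C(n.-1, p) =
    shell_count hB (l / a')%R * 'C(n.-1, p.-1) + shell_count hB (l / b')%R * 'C(n.-1, p))%N.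
  move=> iso l l0; have := congr1 (fun f => f l%:C%C) iso.
  by rewrite !(spectrum_pos hB)// => -[].
have compare : (p < n)%N -> isospectral B p (F_op B a b) (F_op B a' b') ->
    (a = a' /\ b = b') \/ [/\ 'C(n.-1, p.-1) = 'C(n.-1, p), a = b' & b = a'].
  move=> pn' iso; apply: (scaled_counts_eq s0 Ns Nlt) => //; last exact: counts.
  by rewrite bin_gt0; lia.
split.
- move=> n2 /eqP pn'; have {}pn' : (p < n)%N by rewrite ltn_neqAle pn' pn.
  split=> [iso|[-> ->]//]; have [[-> ->]//|[/eqP]] := compare pn' iso.
  by rewrite bin_pred_eqE// => /eqP.
- move=> n2; have pn' : (p < n)%N by lia.
  rewrite set2_eq; split=> [iso|[[-> ->]//|[-> ->]]].
    by have [|[_ -> ->]] := compare pn' iso; [left|right].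
  apply: (spectrum_ext hB) => // l m; rewrite /mode_mult; case: ifP => // _.
  have /eqP -> : 'C(n.-1, p.-1) == 'C(n.-1, p) by rewrite bin_pred_eqE//; apply/eqP.
  by rewrite addnC.
- move=> pn'; split=> [iso|->].
    apply: (scaled_count_inj s0 Ns Nlt) => // l l0.
    have := counts iso l l0; rewrite (_ : 'C(n.-1, p) = 0%N); last by rewrite bin_small//; lia.
    by rewrite !muln0 !addn0 => /eqP; rewrite eqn_pmul2r// => /eqP.
  apply: (spectrum_ext hB) => // l m; rewrite /mode_mult; case: ifP => // _.
  by rewrite (_ : 'C(n.-1, p) = 0%N) ?muln0//; rewrite bin_small//; lia.
Qed.
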